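(* Let $\omega=(\omega_x)_{x\in\mathbb Z}$ be an i.i.d. random environment satisfying $\mathbb E[\log\rho_0]=0$, $\operatorname{Var}(\log\rho_0)>0$ (where $\rho_0=\frac{1-\omega_0}{\omega_0}$), and $\mathbb P(\varepsilon\le\omega_0\le 1-\varepsilon)=1$ for some $\varepsilon\in(0,\tfrac12)$, and let $(X_n)_{n\ge 0}$ be the nearest-neighbour random walk on $\mathbb Z$ in the environment $\omega$, started at $0$, with quenched law $P_\omega$. Then for all $\alpha>0$ and for $\mathbb P$-a.e. $\omega$, $$\sum_{n\in\mathbb N}\big(P_\omega(X_{2n}=0)\big)^{\alpha}=\infty .$$ In particular, for every $d\in\mathbb N$ and for $\mathbb P$-a.e. $\omega$, if $X^{(1)},\dots,X^{(d)}$ are $d$ independent walks in the same environment $\omega$, each with law $P_\omega$ (all started from the origin), then almost surely there are infinitely many $n$ with $X^{(1)}_n=\dots=X^{(d)}_n=0$.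
   Context: $\omega=(\omega_x)_{x\in\mathbb Z}$ is a sequence of i.i.d. random variables with values in $(0,1)$ defined on a probability space $(\Omega,\mathcal F,\mathbb P)$; $\mathbb E$ and $\operatorname{Var}$ refer to $\mathbb P$. Given $\omega$ and $z\in\mathbb Z$, under $P_\omega^z$ the process $(X_n)_{n\ge0}$ is a Markov chain on $\mathbb Z$ with $P^z_\omega(X_0=z)=1$ and $P^z_\omega(X_{n+1}=x+1\mid X_n=x)=\omega_x=1-P^z_\omega(X_{n+1}=x-1\mid X_n=x)$. One writes $P_\omega:=P_\omega^0$. $\mathbb N=\{1,2,\dots\}$. *)

(* Defs.v *)
From HB Require Import structures.
From mathcomp Require Import all_boot all_order all_algebra finmap.
From mathcomp Require Import all_classical all_reals all_analysis.

Set Implicit Arguments.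
Unset Strict Implicit.
Unset Printing Implicit Defensive.

Import Order.TTheory GRing.Theory Num.Theory.

Local Open Scope classical_set_scope.
Local Open Scope ring_scope.

HB.instance Definition _ := isPointed.Build int 0.
HB.instance Definition _ := @isMeasurable.Build default_measure_display
  int discrete_measurable discrete_measurable0
  discrete_measurableC discrete_measurableU.

Section independence.
Context {d : measure_display} {T : measurableType d} {R : realType}.
Variable P : probability T R.

(* F i is meant to be a sub-sigma-algebra for each i. *)
Definition mutually_independent {I : choiceType} (F : I -> set (set T)) :=
  forall (J : {fset I}) (E : I -> set T), (forall i, i \in J -> F i (E i)) ->
    P (\bigcap_(i in [set` J]) E i) = (\prod_(i <- J) P (E i))%E.

Definition iid {I : choiceType} {d'} {S : measurableType d'}
    (Y : I -> {RV P >-> S}) :=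
  mutually_independent (fun i => g_sigma_algebra_preimage (Y i)) /\
  (forall i j (A : set S), measurable A ->
     distribution P (Y i) A = distribution P (Y j) A).

Definition process_sigma_algebra {d'} {S : measurableType d'}
    (X : nat -> {RV P >-> S}) : set (set T) :=
  <<s \bigcup_n g_sigma_algebra_preimage (X n) >>.

(* Meaningful only when P B != 0. *)
Definition cond_prob (A B : set T) : R := fine (P (A `&` B)) / fine (P B).

End independence.

Section random_walk_in_environment.
Context {d : measure_display} {W : measurableType d} {R : realType}.
Variable Q : probability W R.

Definition history (X : nat -> {RV Q >-> int}) (n : nat) (x : nat -> int) :
    set W :=
  [set w | forall k, (k <= n)%N -> X k w = x k].

(* Under Q, X is a Markov chain on the integers with law $P_e^z$: the
   transition probabilities are prescribed conditionally on the whole past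
   X_0 = x 0, ..., X_n = x n, which is the Markov property. *)
Record quenched_walk (e : int -> R) (z : int) (X : nat -> {RV Q >-> int}) :
    Prop := QuenchedWalk {
  quenched_walk_start : Q [set w | X 0 w = z] = 1%E;
  quenched_walk_right : forall n x, Q (history X n x) != 0%E ->
    cond_prob Q [set w | X n.+1 w = x n + 1] (history X n x) = e (x n);
  quenched_walk_left : forall n x, Q (history X n x) != 0%E ->
    cond_prob Q [set w | X n.+1 w = x n - 1] (history X n x) = 1 - e (x n) }.

End random_walk_in_environment.

Definition rho {R : realType} (p : R) : R := (1 - p) / p.

(* Main.v *)
Require Import Defs.
From HB Require Import structures.
From mathcomp Require Import all_boot all_order all_algebra finmap.
From mathcomp Require Import all_classical all_reals all_analysis measurable_realfun.
From mathcomp Require Import ring lra zify.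

Set Implicit Arguments.
Unset Strict Implicit.
Unset Printing Implicit Defensive.

Import Order.TTheory GRing.Theory Num.Theory.

Local Open Scope classical_set_scope.
Local Open Scope ring_scope.

(** A walk in a fixed environment [e] is reversible for the conductances
    [expR (- V x)], where the potential [V] has increments [ln (rho (e x))].
    Suppose that [V] reaches a level [H] on both sides of the origin, at [- a]
    and [b], before falling below [- m].  Two things follow.  The walk stays
    between the two walls up to times of order [expR H], with probability at
    least one half, since each visit to the origin leads across a wall with
    probability at most of order [expR (- H)].  By reversibility the return
    probability at time [2 * n] is a sum of squares, and Cauchy-Schwarz bounds
    it below by the squared survival probability over the reversible measure of
    the valley, which is of order [(a + b) * expR m]; this is
    [return_prob_ge].  If [m] and [ln (a + b)] are at most a small multiple of
    [H / alpha], the [expR H / 4] terms with [n <= expR H / 4] contribute more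
    than a constant times [expR (H / 2)] to the series
    ([valley_series_oo]).

    It remains to find such valleys at arbitrarily large scales.  The potential
    on either side is a centred walk with bounded steps.  By optional stopping
    for the walk and for its square, it climbs to a height proportional to [H]
    before falling below [- del * H], in a time proportional to [H ^+ 2], with
    a probability depending on [del] only ([climb_probability]).  Cut the
    sites into blocks so long that the potential accumulated before a block is
    small compared with the height aimed at in the block.  The events that both
    walls arise within a given block are then independent, and the second
    Borel-Cantelli lemma gives infinitely many of them ([deep_valleys]).

    For [m] walks, independence turns the return probability into its [m]-th
    power, whose sum diverges by the case [alpha = m].  Finally, for any Markov
    chain, the events that [n] is the time of the last visit to the starting
    point are disjoint, and their probabilities are those of the visits times a
    common factor; if the latter have an infinite sum, this factor is [0]
    ([recurrence]). *)

(** * The return probability in a valley *)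

Section quenched_kernel.
Context {R : realType}.
Variable e : int -> R.

Definition kernel_op (f : int -> R) (x : int) : R :=
  e x * f (x + 1) + (1 - e x) * f (x - 1).

(** The probability of being at [0] at time [n], written through the kernel
    alone so that it can be compared with the walk killed outside a valley. *)
Definition return_prob (n : nat) : R :=
  iter n kernel_op (fun x => (x == 0)%:R) 0.

Hypothesis e01 : forall x, 0 < e x < 1.

Lemma kernel_op_le (f g : int -> R) x :
  (forall y, f y <= g y) -> kernel_op f x <= kernel_op g x.
Proof.
move=> fg; have /andP[e0 e1] := e01 x.
by apply: lerD; apply: ler_wpM2l => //; [exact: ltW|rewrite subr_ge0 ltW].
Qed.

Lemma kernel_op_ge0 (f : int -> R) x :
  (forall y, 0 <= f y) -> 0 <= kernel_op f x.
Proof.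
move=> f0; have /andP[e0 e1] := e01 x.
by apply: addr_ge0; apply: mulr_ge0 => //; [exact: ltW|rewrite subr_ge0 ltW].
Qed.

(** Here [c x] is the conductance of the edge between [x] and [x + 1]: the walk
    is reversible for the measure [mu x = c x + c (x - 1)], and the valley is
    the interval from [- a] to [b - 1]. *)
Section valley.
Variables (c : int -> R) (a b : nat).
Hypothesis c0 : forall x, 0 < c x.
Hypothesis cE : forall x, e x * (c x + c (x - 1)) = c x.

Let mu x := c x + c (x - 1).

Let inbox (x : int) := (- a%:Z <= x) && (x < b%:Z).

Let boxsum (F : int -> R) := \sum_(0 <= i < a + b) F (i%:Z - a%:Z).

Let killed_op f x := if inbox x then kernel_op f x else 0.

Let supported (f : int -> R) := forall x, ~~ inbox x -> f x = 0.

Lemma conductance_left x : (1 - e x) * (c x + c (x - 1)) = c (x - 1).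
Proof. by rewrite mulrBl cE mul1r addrAC subrr add0r. Qed.

Let mu_kernel f x :
  mu x * kernel_op f x = c x * f (x + 1) + c (x - 1) * f (x - 1).
Proof.
rewrite /kernel_op mulrDr !mulrA !(mulrC (mu x)).
by rewrite cE conductance_left.
Qed.

Let boxsum_ge0 F : (forall x, inbox x -> 0 <= F x) -> 0 <= boxsum F.
Proof.
move=> F0; rewrite /boxsum big_seq; apply: sumr_ge0 => i.
by rewrite mem_index_iota => /andP[_ ilt]; apply: F0; rewrite /inbox; lia.
Qed.

Let eq_boxsum F G : (forall x, inbox x -> F x = G x) -> boxsum F = boxsum G.
Proof.
move=> FG; rewrite /boxsum; apply: eq_big_nat => i /andP[_ ilt].
by apply: FG; rewrite /inbox; lia.
Qed.

Let boxsumD F G : boxsum F + boxsum G = boxsum (fun x => F x + G x).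
Proof. by rewrite /boxsum -big_split. Qed.

Let boxsum_shift (G : int -> R) :
  G (b%:Z - 1) = 0 -> G (- a%:Z - 1) = 0 ->
  boxsum (fun x => G (x - 1)) = boxsum G.
Proof.
move=> Gb Ga; apply/eqP; rewrite eq_sym -subr_eq0 /boxsum -sumrB.
rewrite (eq_bigr (fun i => (fun k : nat => G (k%:Z - a%:Z - 1)) i.+1 -
   (fun k : nat => G (k%:Z - a%:Z - 1)) i)); last first.
  by move=> i _ /=; congr (G _ - _); lia.
rewrite telescope_sumr //; apply/eqP.
rewrite (_ : (a + b)%N%:Z - a%:Z - 1 = b%:Z - 1); last lia.
by rewrite Gb sub0r (_ : 0%:Z - a%:Z - 1 = - a%:Z - 1) ?Ga ?oppr0 //; lia.
Qed.

(* Reversibility, by a shift of the summation variable: the two boundary terms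
   vanish because [f] and [g] vanish outside the valley. *)
Let killed_adj f g : supported f -> supported g ->
  boxsum (fun x => mu x * (killed_op f x * g x)) =
  boxsum (fun x => mu x * (f x * killed_op g x)).
Proof.
move=> sf sg.
have fb : f b%:Z = 0 by apply: sf; rewrite /inbox; lia.
have gb : g b%:Z = 0 by apply: sg; rewrite /inbox; lia.
have fa : f (- a%:Z - 1) = 0 by apply: sf; rewrite /inbox; lia.
have ga : g (- a%:Z - 1) = 0 by apply: sg; rewrite /inbox; lia.
pose G x := c x * (f (x + 1) * g x).
pose G' x := c x * (f x * g (x + 1)).
transitivity (boxsum G + boxsum (fun x => G' (x - 1))).
  rewrite boxsumD; apply: eq_boxsum => x xbox /=.
  rewrite /killed_op xbox mulrA mu_kernel /G /G' subrK; ring.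
transitivity (boxsum (fun x => G (x - 1)) + boxsum G').
  rewrite !boxsum_shift // /G /G' ?subrK ?fb ?gb ?fa ?ga;
    by rewrite ?(mulr0, mul0r).
rewrite boxsumD; apply: eq_boxsum => x xbox /=.
by rewrite /killed_op xbox mulrCA mu_kernel /G /G' subrK; ring.
Qed.

Let killed_supported f n : supported f -> supported (iter n killed_op f).
Proof.
case: n => [//|n] sf x; rewrite iterS /killed_op.
by move/negbTE ->.
Qed.

Let killed_iter_adj f g n : supported f -> supported g ->
  boxsum (fun x => mu x * (iter n killed_op f x * g x)) =
  boxsum (fun x => mu x * (f x * iter n killed_op g x)).
Proof.
elim: n f => // n IH f sf sg; rewrite iterSr IH //; last first.
  exact: (killed_supported 1).
by rewrite killed_adj //; exact: killed_supported.
Qed.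

Let killed_ge0 f n x : (forall y, 0 <= f y) -> 0 <= iter n killed_op f x.
Proof.
move=> f0; elim: n x => [//|n IH] x; rewrite iterS /killed_op.
by case: ifP => // _; exact: kernel_op_ge0.
Qed.

Let killed_le f n x : (forall y, 0 <= f y) ->
  iter n killed_op f x <= iter n kernel_op f x.
Proof.
move=> f0; elim: n x => [//|n IH] x; rewrite !iterS {1}/killed_op.
case: ifP => _; first exact: kernel_op_le.
apply: kernel_op_ge0 => y; apply: le_trans (IH y); exact: killed_ge0.
Qed.

Let boxsum_delta F : (0 < b)%N -> boxsum (fun x => F x * (x == 0)%:R) = F 0.
Proof.
move=> b0; rewrite /boxsum (bigD1_seq a) /=; last 2 first.
- by rewrite mem_index_iota; lia.
- exact: iota_uniq.
rewrite subrr eqxx mulr1 big1 ?addr0 // => i ia.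
by rewrite (_ : (_ == 0) = false) ?mulr0 //; lia.
Qed.

(* Expand the sum of [mu x * (m * f x - s) ^+ 2], where [m] and [s] are the
   sums of [mu x] and [mu x * f x]. *)
Let cauchy_schwarz f : boxsum (fun x => mu x * f x) ^+ 2 <=
  boxsum mu * boxsum (fun x => mu x * f x ^+ 2).
Proof.
have mu0 x : 0 <= mu x by rewrite addr_ge0 // ltW.
set m := boxsum mu; set s := boxsum _; set q := boxsum _.
have m_ge0 : 0 <= m by exact: boxsum_ge0.
have := m_ge0; rewrite le_eqVlt => /orP[/eqP m0|m_gt0].
  have ab : (a + b = 0)%N.
    case: (posnP (a + b)) => // ab; exfalso.
    have : 0 < m; last by rewrite -m0 ltxx.
    rewrite /m /boxsum big_ltn //; apply: ltr_pwDl; first exact: addr_gt0.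
    by apply: sumr_ge0.
  by rewrite /s /q /m /boxsum ab !big_geq // expr2 !mul0r.
have : 0 <= boxsum (fun x => mu x * (m * f x - s) ^+ 2).
  by apply: boxsum_ge0 => x _; rewrite mulr_ge0 // sqr_ge0.
have -> : boxsum (fun x => mu x * (m * f x - s) ^+ 2) = m * (m * q - s ^+ 2).
  transitivity (m ^+ 2 * q - 2 * m * s * s + s ^+ 2 * m).
    have E x : mu x * (m * f x - s) ^+ 2 = m ^+ 2 * (mu x * f x ^+ 2) -
        2 * m * s * (mu x * f x) + s ^+ 2 * mu x by ring.
    by rewrite /boxsum; under eq_bigr do rewrite E;
      rewrite big_split sumrB -!mulr_sumr.
  by clearbody m s q; ring.
by rewrite pmulr_rge0 // subr_ge0.
Qed.

Section escape.
Variable h : R.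
Hypothesis h0 : 0 < h.

Let r x := (c x)^-1 / h.

(* The effective resistance between [0] and [x], in units of [h].  It is
   harmonic away from [0] and at least [1] at both exits from the valley, so
   each step costs at most [2 / h], the defect of harmonicity at [0]. *)
Let psi (x : int) : R :=
  match x with
  | Posz n => \sum_(0 <= j < n) r j%:Z
  | Negz k => \sum_(0 <= j < k.+1) r (Negz j)
  end.

Let r_gt0 x : 0 < r x.
Proof. by rewrite divr_gt0 ?invr_gt0. Qed.

Let psi0 : psi 0 = 0.
Proof. by rewrite /psi /= big_geq. Qed.

Let psi_ge0 x : 0 <= psi x.
Proof. by case: x => n; apply: sumr_ge0 => i _; exact/ltW/r_gt0. Qed.

Let psi_pos x : 0 <= x -> psi (x + 1) = psi x + r x.
Proof.
case: x => // n _; rewrite (_ : Posz n + 1 = Posz n.+1) /=; last lia.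
by rewrite big_nat_recr.
Qed.

Let psi_neg x : x < 0 -> psi x = psi (x + 1) + r x.
Proof.
case: x => // [] [|n] _.
  by rewrite (_ : Negz 0 + 1 = 0) //= big_nat1 big_geq // add0r.
rewrite (_ : Negz n.+1 + 1 = Negz n) /=; last lia.
by rewrite [LHS]big_nat_recr.
Qed.

Let mu_gt0 x : 0 < mu x.
Proof. exact: addr_gt0. Qed.

Let er x : e x * r x = (mu x * h)^-1.
Proof.
rewrite /r -(cE x) invfM !mulrA invfM -/(mu x); have /andP[ex _] := e01 x.
by rewrite divff ?mul1r // gt_eqF.
Qed.

Let el x : (1 - e x) * r (x - 1) = (mu x * h)^-1.
Proof.
rewrite /r -(conductance_left x) invfM !mulrA invfM -/(mu x).
by have /andP[_ ex] := e01 x; rewrite divff ?mul1r // subr_eq0 gt_eqF.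
Qed.

Let psi_super x : c 0 = 1 -> kernel_op psi x <= psi x + 2 / h.
Proof.
move=> c01.
have h2 : 0 <= 2 / h by rewrite divr_ge0 // ltW.
rewrite /kernel_op.
have [x0|x0|x0] := ltrgtP x 0.
- have -> : psi (x - 1) = psi x + r (x - 1) by rewrite psi_neg ?subrK //; lia.
  have -> : psi (x + 1) = psi x - r x by rewrite (psi_neg x0) addrK.
  rewrite mulrBr mulrDr er el; nra.
- have -> : psi (x + 1) = psi x + r x by rewrite psi_pos // ltW.
  have -> : psi (x - 1) = psi x - r (x - 1).
    have x1 : 0 <= x - 1 by lia.
    by have := psi_pos x1; rewrite subrK => ->; rewrite addrK.
  rewrite mulrBr mulrDr er el; nra.
- rewrite x0 psi0 (psi_pos (lexx 0)) (@psi_neg (0 - 1)) // subrK psi0 !add0r.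
  rewrite er (_ : -1 = 0 - 1) // el -mulr2n -(mulr_natl (_ ^-1)).
  rewrite ler_wpM2l // lef_pV2 ?posrE ?mulr_gt0 // -{1}(mul1r h) ler_pM2r //.
  by rewrite /mu c01 lerDl ltW.
Qed.

(** By comparison with the resistance: the probability of leaving the valley
    before time [n] satisfies the recursion of which [psi x + n * (2 / h)] is a
    supersolution. *)
Lemma killed_survival (n : nat) : c 0 = 1 -> (0 < b)%N ->
  c (b%:Z - 1) <= h^-1 -> c (- a%:Z - 1) <= h^-1 ->
  1 - n%:R * (2 / h) <= iter n killed_op (fun x => (inbox x)%:R) 0.
Proof.
move=> c01 b0 cb ca.
have r1 x : c x <= h^-1 -> 1 <= r x.
  move=> cx; rewrite /r ler_pdivlMr // mul1r -(invrK h) lef_pV2 //;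
  by rewrite posrE ?invr_gt0.
have psib : 1 <= psi b%:Z.
  have -> : psi b%:Z = psi (b%:Z - 1) + r (b%:Z - 1).
    by rewrite -psi_pos ?subrK //; lia.
  by rewrite -[1]add0r lerD // r1.
have psia : 1 <= psi (- a%:Z - 1).
  rewrite psi_neg; last lia.
  by rewrite -[1]add0r lerD // r1.
suff H x : - a%:Z - 1 <= x <= b%:Z ->
    1 - iter n killed_op (fun x => (inbox x)%:R) x <= psi x + n%:R * (2 / h).
  have := H 0; rewrite psi0 add0r => /(_ ltac:(lia)); lra.
have h2 : 0 <= 2 / h by rewrite divr_ge0 // ltW.
elim: n x => [|n IH] x xb.
  rewrite mul0r addr0 /=; case: (boolP (inbox x)) => xbox.
    by rewrite subrr.
  rewrite subr0; suff [->|->] : x = b%:Z \/ x = - a%:Z - 1 by [].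
  by move: xbox; rewrite /inbox; lia.
rewrite iterS {1}/killed_op; case: (boolP (inbox x)) => xbox; last first.
  rewrite subr0; apply: ler_wpDr; first by rewrite mulr_ge0.
  suff [->|->] : x = b%:Z \/ x = - a%:Z - 1 by [].
  by move: xbox; rewrite /inbox; lia.
have Hr := IH (x + 1); have Hl := IH (x - 1).
have {}Hr := Hr ltac:(move: xbox; rewrite /inbox; lia).
have {}Hl := Hl ltac:(move: xbox; rewrite /inbox; lia).
have /andP[e0 e1] := e01 x.
have := @psi_super x c01; rewrite /kernel_op -natr1.
move: (iter n _ _ _) (iter n _ _ _) Hr Hl => p q.
move: (psi (x + 1)) (psi (x - 1)) (psi x) (2 / h) => pr pl px w Hr Hl H.
rewrite mulrDl mul1r.
have A1 := ler_wpM2l (ltW e0) Hr.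
have e1' : 0 <= 1 - e x by rewrite subr_ge0 ltW.
have A2 := ler_wpM2l e1' Hl.
lra.
Qed.

End escape.

(** Restrict the walk to the valley, where its kernel is self-adjoint for the
    reversible measure.  Then the return probability at an even time is the
    squared norm of the distribution at half that time, and Cauchy-Schwarz
    bounds this norm below by the mass still inside the valley, divided by the
    total reversible measure of the valley. *)
Lemma return_prob_ge (h K : R) (n : nat) : c 0 = 1 -> (0 < b)%N -> 0 < h ->
  c (b%:Z - 1) <= h^-1 -> c (- a%:Z - 1) <= h^-1 ->
  (forall x, - a%:Z - 1 <= x < b%:Z -> c x <= K) ->
  n%:R * 4 <= h ->
  (8 * (a + b)%:R * K)^-1 <= return_prob (n + n).
Proof.
move=> c01 b0 h0 cb ca cK nh.
have surv := killed_survival h0 n c01 b0 cb ca.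
have {}surv : 1 / 2 <= iter n killed_op (fun x => (inbox x)%:R) 0.
  apply: le_trans surv; rewrite mulrA lerBrDl -lerBrDr ler_pdivrMr //; lra.
pose delta0 (x : int) : R := (x == 0)%:R.
have d0 x : 0 <= delta0 x by rewrite ler0n.
have sd : supported delta0.
  by move=> x; rewrite /delta0 /inbox; case: eqP => // ->; lia.
have s1 : supported (fun x => (inbox x)%:R : R) by move=> x /negbTE ->.
pose g := iter n killed_op delta0.
have gg : boxsum (fun x => mu x * g x ^+ 2) <= mu 0 * return_prob (n + n).
  have -> : boxsum (fun x => mu x * g x ^+ 2) =
      boxsum (fun x => mu x * (delta0 x * iter (n + n) killed_op delta0 x)).
    rewrite iterD -killed_iter_adj //; last exact: killed_supported.
  rewrite (_ : boxsum _ =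
    boxsum (fun x => (mu x * iter (n + n) killed_op delta0 x) * delta0 x)).
    by rewrite boxsum_delta // ler_pM2l ?addr_gt0 // killed_le.
  by apply: eq_boxsum => x _; rewrite mulrCA mulrC.
have g1 : boxsum (fun x => mu x * g x) =
    mu 0 * iter n killed_op (fun x => (inbox x)%:R) 0.
  rewrite -(@boxsum_delta (fun x => mu x * iter n killed_op _ x)) //.
  transitivity (boxsum (fun x => mu x * (g x * (inbox x)%:R))).
    by apply: eq_boxsum => x ->; rewrite mulr1.
  rewrite killed_iter_adj //; apply: eq_boxsum => x _; rewrite /delta0; ring.
have mu0 : 1 <= mu 0 by rewrite /mu c01 lerDl ltW.
have muK : boxsum mu <= 2 * (a + b)%:R * K.
  have -> : 2 * (a + b)%:R * K = boxsum (fun=> 2 * K).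
    by rewrite /boxsum sumr_const_nat subn0 -[RHS]mulr_natr mulrAC.
  rewrite /boxsum !big_seq; apply: ler_sum => i; rewrite mem_index_iota => ilt.
  rewrite /mu (_ : 2 * K = K + K); last by ring.
  by apply: lerD; apply: cK; lia.
have ab : (0 : R) < (a + b)%:R by rewrite ltr0n; lia.
have K0 : 0 < K by apply: lt_le_trans (c0 0) (cK _ _); lia.
have := cauchy_schwarz g; rewrite g1 => cs.
have ret0 : 0 <= return_prob (n + n).
  by rewrite -(pmulr_rge0 _ (lt_le_trans ltr01 mu0)); apply: le_trans gg;
    apply: boxsum_ge0 => x _; rewrite mulr_ge0 ?sqr_ge0 // ltW ?addr_gt0.
have mug : 0 <= boxsum (fun x => mu x * g x ^+ 2).
  by apply: boxsum_ge0 => x _; rewrite mulr_ge0 ?sqr_ge0 // ltW ?addr_gt0.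
rewrite -[leLHS]mul1r ler_pdivrMr ?mulr_gt0 //.
move: (iter n killed_op _ 0) surv cs => p p2 cs.
have m0 : 0 <= boxsum mu by apply: boxsum_ge0 => x _; rewrite ltW ?addr_gt0.
move: (boxsum mu) (boxsum _) m0 muK gg mug cs => m q m0 muK gg mug cs.
move: (return_prob _) ret0 gg => u u0 gg.
have h1 : (mu 0 * p) ^+ 2 <= 2 * (a + b)%:R * K * (mu 0 * u).
  apply: (le_trans cs); apply: ler_pM => //.
rewrite exprMn expr2 -mulrA (mulrCA _ (mu 0)) ler_pM2l in h1; last first.
  exact: lt_le_trans mu0.
have p4 : 1 / 4 <= mu 0 * p ^+ 2.
  have : 1 / 4 <= p ^+ 2 by nra.
  have := sqr_ge0 p; move: (p ^+ 2) => pp; nra.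
rewrite (_ : u * _ = 4 * (2 * (a + b)%:R * K * u)); last by ring.
lra.
Qed.

End valley.
End quenched_kernel.

(** * Valleys of the potential *)

Section divergence.
Context {R : realType}.
Variable e : int -> R.
Hypothesis e01 : forall x, 0 < e x < 1.

(** The potential [V] with [V 0 = 0] and [V x - V (x - 1) = ln (rho (e x))]; the
    walk is reversible for the conductances [expR (- V x)]. *)
Definition potential (x : int) : R :=
  match x with
  | Posz n => \sum_(0 <= j < n) ln (rho (e (j%:Z + 1)))
  | Negz k => \sum_(0 <= j < k.+1) - ln (rho (e (- j%:Z)))
  end.

Lemma rho_gt0 (p : R) : 0 < p < 1 -> 0 < rho p.
Proof. by move=> /andP[p0 p1]; rewrite /rho divr_gt0 // subr_gt0. Qed.

Lemma potential0 : potential 0 = 0.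
Proof. by rewrite /= big_geq. Qed.

Lemma potential_pos (n : nat) :
  potential n%:Z = \sum_(0 <= j < n) ln (rho (e (j%:Z + 1))).
Proof. by []. Qed.

Lemma potential_neg (n : nat) :
  potential (- n%:Z) = \sum_(0 <= j < n) - ln (rho (e (- j%:Z))).
Proof.
case: n => [|n]; first by rewrite oppr0 potential0 big_geq.
by rewrite -NegzE.
Qed.

Lemma potential_step x : potential x = potential (x - 1) + ln (rho (e x)).
Proof.
case: x => [[|n]|n].
- by rewrite (_ : 0%:Z - 1 = Negz 0) //= big_nat1 big_geq // oppr0 addNr.
- rewrite (_ : n.+1%:Z - 1 = n%:Z) /=; last lia.
  by rewrite big_nat_recr //= (_ : n%:Z + 1 = n.+1%:Z) //; lia.
- rewrite (_ : Negz n - 1 = Negz n.+1) /=; last lia.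
  by rewrite [in RHS]big_nat_recr //= -NegzE subrK.
Qed.

Definition conductance x := expR (- potential x).

Lemma conductance_reversible x :
  e x * (conductance x + conductance (x - 1)) = conductance x.
Proof.
have rx := rho_gt0 (e01 x); have /andP[e0 _] := e01 x.
have -> : conductance (x - 1) = conductance x * rho (e x).
  rewrite /conductance (potential_step x) opprD expRD -mulrA -{2}(lnK rx).
  by rewrite -expRD addNr expR0 mulr1.
rewrite -{1}(mulr1 (conductance x)) -mulrDr mulrCA /rho mulrDr mulr1 mulrCA.
by rewrite divff ?gt_eqF // mulr1 addrC subrK mulr1.
Qed.

(** The walls at [b] and [- a] have height at least [H], and the potential in
    between does not fall below [- m]: the walk is trapped for a time of order
    [expR H], in a region whose reversible measure is of order
    [(a + b) * expR m]. *)
Definition valley (H m : R) (a b : nat) :=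
  [/\ H <= potential b%:Z, H <= potential (- a%:Z),
      (forall i, (i <= b)%N -> - m <= potential i%:Z) &
      (forall i, (i <= a)%N -> - m <= potential (- i%:Z))].

Lemma valley_return_prob (H m : R) (a b n : nat) : (0 < a)%N ->
  valley H m a b -> n%:R * 4 <= expR H ->
  (8 * (a + b)%:R * expR m)^-1 <= return_prob e (n + n).
Proof.
move=> a0 [Hb Ha mb ma] nH.
have low x : potential x >= H -> conductance x <= (expR H)^-1.
  by move=> Hx; rewrite -expRN ler_expR lerN2.
have := @return_prob_ge R e e01 conductance a.-1 b.+1
  (fun x => expR_gt0 _) conductance_reversible (expR H) (expR m) n.
rewrite (_ : a.-1 + b.+1 = a + b)%N; last lia.
apply => //.
- by rewrite /conductance potential0 oppr0 expR0.
- exact: expR_gt0.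
- by rewrite (_ : b.+1%:Z - 1 = b%:Z) ?low //; lia.
- by rewrite (_ : - a.-1%:Z - 1 = - a%:Z) ?low //; lia.
- move=> x xab; rewrite /conductance ler_expR lerNl.
  case: (leP 0 x) => x0.
    by rewrite -(gez0_abs x0) mb //; lia.
  have -> : x = - `|x|%N%:Z by lia.
  by apply: ma; lia.
Qed.

(** A valley of depth [H] keeps the walk for a time of order [expR H], and
    [alpha] times the logarithm of the loss in return probability is at most
    half of the depth; a single valley then contributes at least about
    [expR (H / 2) / 4] to the series. *)
Lemma valley_series_oo (alpha : R) : 0 < alpha ->
  (forall C : R, exists H a b, [/\ C <= H, (0 < a)%N,
     valley H (H / (4 * alpha)) a b &
     8 * (a + b)%:R <= expR (H / (4 * alpha))]) ->
  (\sum_(1 <= n <oo) ((return_prob e (2 * n)) `^ alpha)%:E = +oo)%E.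
Proof.
move=> al0 Hv; apply/eqyP => C C0.
have [H [a [b [CH a0 Hval abH]]]] := Hv (Num.max 2 (8 * C + 8)).
have H2 : 2 <= H by apply: le_trans CH; rewrite le_max lexx.
have HC : 8 * C + 8 <= H by apply: le_trans CH; rewrite le_max lexx orbT.
set del := H / (4 * alpha) in abH Hval.
(* The walk has survived in the valley up to time [N] with probability at
   least one half. *)
pose N := Num.truncn (expR H / 4).
have N1 : expR H / 4 < N.+1%:R by rewrite truncnS_gt.
have N2 : N%:R * 4 <= expR H.
  by rewrite -ler_pdivlMr // truncn_le // divr_ge0 // expR_ge0.
have term n : (n <= N)%N -> expR (- (H / 2)) <= return_prob e (2 * n) `^ alpha.
  move=> nN.
  have nH : n%:R * 4 <= expR H.
    by apply: le_trans N2; rewrite ler_wpM2r // ler_nat.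
  have := valley_return_prob a0 Hval nH; rewrite addnn -mul2n => ge.
  have {}ge : expR (- (2 * del)) <= return_prob e (2 * n).
    apply: le_trans ge; rewrite expRN lef_pV2 ?posrE ?expR_gt0 //; last first.
      by rewrite !mulr_gt0 ?expR_gt0 ?ltr0n //; lia.
    by rewrite (_ : 2 * del = del + del) ?expRD ?ler_pM2r ?expR_gt0 //; ring.
  have -> : expR (- (H / 2)) = expR (- (2 * del)) `^ alpha.
    rewrite /powR gt_eqF ?expR_gt0 // expRK /del; congr expR.
    by field; rewrite gt_eqF.
  by rewrite ge0_ler_powR ?nnegrE ?expR_ge0 ?(ltW al0) // (le_trans _ ge) ?expR_ge0.
have nn n : (0 <= (return_prob e (2 * n) `^ alpha)%:E)%E by rewrite lee_fin powR_ge0.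
apply: le_trans (nneseries_lim_ge N.+1 _); last by move=> *; exact: nn.
rewrite sumEFin lee_fin.
apply: (@le_trans _ _ (\sum_(1 <= n < N.+1) expR (- (H / 2)))); last first.
  by rewrite big_nat [leRHS]big_nat; apply: ler_sum => n ?; apply: term; lia.
rewrite sumr_const_nat subSS subn0 -[leRHS]mulr_natl.
have X1 : 1 + H / 2 <= expR (H / 2) by exact: expR_ge1Dx.
have XX : expR (H / 2) * expR (- (H / 2)) = 1 by rewrite -expRD subrr expR0.
have XH : expR H = expR (H / 2) * expR (H / 2) by rewrite -expRD; congr expR; lra.
have Y0 := expR_gt0 (- (H / 2)).
have Y1 : expR (- (H / 2)) <= 1.
  by rewrite -expR0 ler_expR oppr_le0 divr_ge0 // (le_trans _ H2).
have NS : N.+1%:R = N%:R + 1 :> R by rewrite -natr1.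
rewrite XH NS in N1.
have aux (X Y Z c : R) : X * Y = 1 -> X * X / 4 < Z + 1 -> 0 < Y -> Y <= 1 ->
    4 * c + 5 <= X -> c <= Z * Y.
  move=> XY ZX Y_gt0 Yle X5.
  have NY : (X * X / 4 - 1) * Y <= Z * Y by apply: ler_wpM2r; lra.
  apply: le_trans NY; rewrite (_ : _ * Y = (X * Y) * X / 4 - Y); last by field.
  by rewrite XY mul1r; lra.
by apply: (aux _ _ _ _ XX N1 Y0 Y1); apply: le_trans X1; lra.
Qed.

End divergence.

(** * Bounded random variables and independence *)

Section bounded_random_variables.
Context {d : measure_display} {T : measurableType d} {R : realType}.
Variable P : probability T R.

Definition bounded_rv (f : T -> R) :=
  measurable_fun setT f /\ exists C : R, forall t, `|f t| <= C.

Definition independent_rv (X Y : T -> R) := forall A B : set R,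
  measurable A -> measurable B ->
  P (X @^-1` A `&` Y @^-1` B) = (P (X @^-1` A) * P (Y @^-1` B))%E.

Lemma bounded_rv_integrable f : bounded_rv f -> P.-integrable setT (EFin \o f).
Proof.
move=> [mf [C fC]]; apply: measurable_bounded_integrable => //.
  by apply: (@le_lt_trans _ _ 1%E); [exact: probability_le1|rewrite ltry].
exists C; split; rewrite ?num_real // => M CM t _.
exact: le_trans (fC t) (ltW CM).
Qed.

Lemma bounded_rvD f g : bounded_rv f -> bounded_rv g ->
  bounded_rv (fun t => f t + g t).
Proof.
move=> [mf [C fC]] [mg [D gD]]; split; first exact: measurable_funD.
exists (C + D) => t; apply: le_trans (ler_normD _ _) _; exact: lerD.
Qed.

Lemma bounded_rvM f g : bounded_rv f -> bounded_rv g ->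
  bounded_rv (fun t => f t * g t).
Proof.
move=> [mf [C fC]] [mg [D gD]]; split; first exact: measurable_funM.
by exists (C * D) => t; rewrite normrM ler_pM.
Qed.

Lemma bounded_rv_cst r : bounded_rv (fun=> r).
Proof. by split; [exact: measurable_cst|exists `|r|]. Qed.

Lemma bounded_rv_bool (b : T -> bool) : measurable_fun setT b ->
  bounded_rv (fun t => (b t)%:R).
Proof.
move=> mb; split.
  rewrite (_ : (fun t => _) = (fun t => if b t then 1 else 0)).
    by apply: measurable_fun_ifT => //; exact: measurable_cst.
  by apply/funext => t; case: (b t).
by exists 1 => t; case: (b t); rewrite ?normr1 ?normr0.
Qed.

Lemma RintegralD_bounded f g : bounded_rv f -> bounded_rv g ->
  \int[P]_t (f t + g t) = \int[P]_t f t + \int[P]_t g t.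
Proof. by move=> bf bg; rewrite RintegralD //; exact: bounded_rv_integrable. Qed.

Lemma RintegralZ_bounded f r : bounded_rv f ->
  \int[P]_t (r * f t) = r * \int[P]_t f t.
Proof. by move=> bf; rewrite RintegralZl //; exact: bounded_rv_integrable. Qed.

Lemma le_Rintegral_bounded f g : bounded_rv f -> bounded_rv g ->
  (forall t, f t <= g t) -> \int[P]_t f t <= \int[P]_t g t.
Proof.
by move=> bf bg fg; rewrite le_Rintegral //; exact: bounded_rv_integrable.
Qed.

Lemma Rintegral_cst_probability r : \int[P]_t r = r.
Proof. by rewrite Rintegral_cst //= probability_setT mulr1. Qed.

Lemma Rintegral_bool (b : T -> bool) : measurable_fun setT b ->
  \int[P]_t (b t)%:R = fine (P [set t | b t]).
Proof.
move=> mb; have mB : measurable [set t | b t].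
  by rewrite -[X in measurable X]setTI; exact: (mb measurableT [set true]).
have := integral_indic P measurableT mB; rewrite setIT => <-.
rewrite /Rintegral; congr fine; apply: eq_integral => t _; rewrite indicE.
by case: (boolP (b t)) => bt; [rewrite mem_set|rewrite memNset //; exact/negP].
Qed.

(** Independence says that the joint law of [X] and [Y] agrees with the product
    of their laws on rectangles, hence everywhere; conclude by Tonelli. *)
Lemma ge0_independent_integral (X Y : T -> R) :
  measurable_fun setT X -> measurable_fun setT Y ->
  (forall t, 0 <= X t) -> (forall t, 0 <= Y t) -> independent_rv X Y ->
  (\int[P]_t (X t * Y t)%:E = \int[P]_t (X t)%:E * \int[P]_t (Y t)%:E)%E.
Proof.
move=> mX mY X0 Y0 XY.
have mXY : measurable_fun setT (fun t => (X t, Y t)).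
  exact: measurable_fun_pair.
pose X' : {RV P >-> R} := mfun_Sub (mem_set mX).
pose Y' : {RV P >-> R} := mfun_Sub (mem_set mY).
pose XY' : {RV P >-> (R * R)%type} := mfun_Sub (mem_set mXY).
pose f (z : R * R) : \bar R := (`|z.1|%:E * `|z.2|%:E)%E.
have mabs : measurable_fun [set: R] (fun x : R => `|x|%:E).
  by apply: measurableT_comp => //; exact: normr_measurable.
have mf : measurable_fun setT f.
  apply: emeasurable_funM; apply/measurable_EFinP; apply: measurableT_comp => //.
have f0 z : (0 <= f z)%E by rewrite mule_ge0.
transitivity (\int[distribution P XY']_z f z)%E.
  rewrite ge0_integral_distribution //; apply: eq_integral => t _.
  by rewrite /f /= -EFinM !ger0_norm.
transitivity (\int[distribution P X' \x distribution P Y']_z f z)%E.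
  apply: eq_measure_integral => A mA _; apply/esym.
  by apply: product_measure_unique => // B C mB mC; exact: XY.
rewrite fubini_tonelli1 //.
transitivity (\int[distribution P X']_x (`|x|%:E * \int[P]_t (Y t)%:E))%E.
  apply: eq_integral => x _; rewrite /fubini_F /f /= ge0_integralZl //.
  congr (_ * _)%E; rewrite ge0_integral_distribution //.
  by apply: eq_integral => t _; rewrite /= ger0_norm.
rewrite ge0_integralZr //; last by apply: integral_ge0 => t _; rewrite lee_fin.
congr (_ * _)%E; rewrite ge0_integral_distribution //.
by apply: eq_integral => t _; rewrite /= ger0_norm.
Qed.

Lemma independent_rv_comp (X Y : T -> R) (f g : R -> R) :
  measurable_fun setT f -> measurable_fun setT g ->
  independent_rv X Y -> independent_rv (f \o X) (g \o Y).
Proof.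
move=> mf mg XY A B mA mB.
have mfA : measurable (f @^-1` A) by rewrite -[_ @^-1` _]setTI; exact: mf.
have mgB : measurable (g @^-1` B) by rewrite -[_ @^-1` _]setTI; exact: mg.
exact: (XY _ _ mfA mgB).
Qed.

(** Adding constants to bounded variables reduces to the nonnegative case. *)
Lemma independent_Rintegral (X Y : T -> R) :
  bounded_rv X -> bounded_rv Y -> independent_rv X Y ->
  \int[P]_t (X t * Y t) = \int[P]_t X t * \int[P]_t Y t.
Proof.
move=> bX bY XY; have [mX [C XC]] := bX; have [mY [D YD]] := bY.
have mshift (c : R) : measurable_fun setT (fun x : R => x + c).
  by apply: measurable_funD => //; exact: measurable_cst.
have bXC : bounded_rv (fun t => X t + C) by apply/bounded_rvD/bounded_rv_cst.
have bYD : bounded_rv (fun t => Y t + D) by apply/bounded_rvD/bounded_rv_cst.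
have : \int[P]_t ((X t + C) * (Y t + D)) =
    \int[P]_t (X t + C) * \int[P]_t (Y t + D).
  rewrite /Rintegral ge0_independent_integral; first last.
  - exact: (independent_rv_comp (mshift C) (mshift D) XY).
  - by move=> t; have := YD t; rewrite ler_norml; lra.
  - by move=> t; have := XC t; rewrite ler_norml; lra.
  - by case: bYD.
  - by case: bXC.
  by rewrite fineM //; apply: integrable_fin_num => //;
    exact: bounded_rv_integrable.
rewrite (_ : (fun t => _) = fun t => X t * Y t + (D * X t + (C * Y t + C * D)));
  last by apply/funext => t; ring.
have bXY := bounded_rvM bX bY.
have bDX := bounded_rvM (bounded_rv_cst D) bX.
have bCY := bounded_rvM (bounded_rv_cst C) bY.
have bCD := bounded_rv_cst (C * D).
rewrite (RintegralD_bounded bXY (bounded_rvD bDX (bounded_rvD bCY bCD))).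
rewrite (RintegralD_bounded bDX (bounded_rvD bCY bCD)).
rewrite (RintegralD_bounded bCY bCD) (RintegralZ_bounded D bX).
rewrite (RintegralZ_bounded C bY) Rintegral_cst_probability.
rewrite (RintegralD_bounded bX (bounded_rv_cst C)) Rintegral_cst_probability.
rewrite (RintegralD_bounded bY (bounded_rv_cst D)) Rintegral_cst_probability.
move: (\int[P]_t (X t * Y t)) (\int[P]_t X t) (\int[P]_t Y t) => p q r; lra.
Qed.

End bounded_random_variables.

(** * Exit of a centred walk from an interval *)

Section stopped_walk.
Context {R : realType}.
Variables (A B : R).
Hypotheses (A0 : 0 < A) (B0 : 0 < B).

(** The walk with steps [s], frozen once it has left the interval from [- A] to
    [B].  The recursion avoids stopping times: the increment is the product of
    a function of the past and an independent step. *)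
Fixpoint stopped (s : nat -> R) (n : nat) : R :=
  if n is m.+1 then
    stopped s m + (- A < stopped s m < B)%R%:R * s m
  else 0.

Definition climbs (s : nat -> R) (n : nat) := exists j, [/\ (j <= n)%N,
  B <= \sum_(0 <= i < j) s i &
  forall k, (k <= j)%N -> - A <= \sum_(0 <= i < k) s i].

Lemma stopped_climbs (s : nat -> R) n : B <= stopped s n -> climbs s n.
Proof.
suff [_] : (- A < stopped s n < B ->
    stopped s n = \sum_(0 <= i < n) s i /\
    forall k, (k <= n)%N -> - A <= \sum_(0 <= i < k) s i) /\
  (B <= stopped s n -> climbs s n) by [].
elim: n => [|n [IH1 IH2]].
  split=> [_|/=]; last by rewrite leNgt B0.
  split=> [|k]; first by rewrite big_geq.
  by rewrite leqn0 => /eqP ->; rewrite big_geq // oppr_le0 ltW.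
rewrite /=; case: (boolP (- A < stopped s n < B)) => act; last first.
  rewrite mul0r addr0; split => [act'|/IH2[j [jn Bj low]]].
    by rewrite act' in act.
  by exists j; split => //; exact: leq_trans jn _.
have [E low] := IH1 act.
rewrite mul1r E -big_nat_recr //=; split => [/andP[low' _]|top].
  split=> // k; rewrite leq_eqVlt ltnS => /orP[/eqP ->|]; last exact: low.
  exact: ltW.
exists n.+1; split => // k; rewrite leq_eqVlt ltnS => /orP[/eqP ->|].
  by apply: le_trans top; have a0 := A0; have b0 := B0; lra.
exact: low.
Qed.

(** Steps bounded by [M] change the sums by at most [M * l] before time [l]. *)
Lemma climbs_shift (M : R) (s : nat -> R) (l n : nat) :
  (forall i, `|s i| <= M) -> climbs (fun i => s (l + i)%N) n ->
  exists j, [/\ (l <= j <= l + n)%N,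
    B - M * l%:R <= \sum_(0 <= i < j) s i &
    forall k, (k <= j)%N -> - (M * l%:R + A) <= \sum_(0 <= i < k) s i].
Proof.
clear B0; move=> sM [j [jn Bj low]].
have init k : (k <= l)%N -> - (M * l%:R) <= \sum_(0 <= i < k) s i.
  move=> kl; have M0 : 0 <= M by exact: le_trans (normr_ge0 _) (sM 0).
  apply: (@le_trans _ _ (- (M * k%:R))).
    by rewrite lerN2 ler_wpM2l // ler_nat.
  rewrite -mulNr (_ : - M * k%:R = \sum_(0 <= i < k) - M); last first.
    by rewrite sumr_const_nat subn0 mulr_natr.
  by apply: ler_sum => i _; have := sM i; rewrite ler_norml => /andP[].
have split k : \sum_(0 <= i < l + k) s i =
    \sum_(0 <= i < l) s i + \sum_(0 <= i < k) s (l + i)%N.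
  rewrite (@big_cat_nat _ _ _ l) /=; [|by []|exact: leq_addr].
  congr (_ + _); rewrite -{1}[l]add0n big_addn addKn.
  by apply: eq_bigr => i _; rewrite addnC.
exists (l + j)%N; split.
- by rewrite leq_addr leq_add2l.
- by rewrite split; have := init l (leqnn l); lra.
- move=> k kj; case: (leqP k l) => kl.
    by apply: le_trans (init k kl); rewrite lerN2 lerDl ltW.
  rewrite -(subnKC (ltnW kl)) split opprD; apply: lerD; first exact: init.
  by apply: low; lia.
Qed.

Section bounds.
Variables (s : nat -> R) (M : R).
Hypothesis sM : forall n, `|s n| <= M.

Lemma stopped_bounds n : - (A + M) <= stopped s n <= B + M.
Proof.
have a0 := A0; have b0 := B0.
have M0 : 0 <= M by exact: le_trans (normr_ge0 _) (sM 0).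
elim: n => [|n IH] /=; first by apply/andP; split; lra.
case: (boolP (- A < stopped s n < B)) => act; last by rewrite mul0r addr0.
have := sM n; rewrite ler_norml mul1r => /andP[s1 s2].
move: act => /andP[a1 a2]; apply/andP; split; lra.
Qed.

Lemma stopped_active_le m n : (m <= n)%N ->
  - A < stopped s n < B -> - A < stopped s m < B.
Proof.
move=> /subnK <-; elim: (n - m)%N => // k IH; rewrite addSn /=.
case: (boolP (- A < stopped s (k + m) < B)) => act; first by move=> _; exact: IH.
by rewrite mul0r addr0 => act'; rewrite act' in act.
Qed.

End bounds.
End stopped_walk.

Lemma measurable_stopped d (T : measurableType d) (R : realType) (A B : R)
    (s : nat -> T -> R) (n : nat) :
  (forall k, (k < n)%N -> measurable_fun setT (s k)) ->
  measurable_fun setT (fun t => stopped A B (s^~ t) n).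
Proof.
elim: n => [|n IH] ms; first exact: measurable_cst.
have mY : measurable_fun setT (fun t => stopped A B (s^~ t) n).
  by apply: IH => k kn; apply: ms; exact: ltnW.
apply: measurable_funD => //; apply: measurable_funM; last exact: ms.
apply: (@bounded_rv_bool _ _ R _ _).1.
by apply: measurable_and; apply: measurable_fun_ltr => //; exact: measurable_cst.
Qed.

Section gambler.
Context {d : measure_display} {T : measurableType d} {R : realType}.
Variables (P : probability T R) (A B M v : R) (s : nat -> T -> R).
Hypotheses (A0 : 0 < A) (B0 : 0 < B) (v0 : 0 < v).
Hypothesis ms : forall n, measurable_fun setT (s n).
Hypothesis sM : forall n t, `|s n t| <= M.
Hypothesis s_mean : forall n, \int[P]_t s n t = 0.
Hypothesis s_var : forall n, \int[P]_t (s n t ^+ 2) = v.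

Let Y n t := stopped A B (s^~ t) n.
Hypothesis s_ind : forall n, independent_rv P (Y n) (s n).

Let active n t := - A < Y n t < B.

Let M0 : 0 <= M.
Proof. exact: le_trans (normr_ge0 _) (sM 0 point). Qed.

Let measurable_active_gen (f : T -> R) : measurable_fun setT f ->
  measurable_fun setT (fun t => - A < f t < B).
Proof.
by move=> mf; apply: measurable_and; apply: measurable_fun_ltr => //;
  exact: measurable_cst.
Qed.

Let bs n : bounded_rv (s n).
Proof. by split; [exact: ms|exists M]. Qed.

Let mY n : measurable_fun setT (Y n).
Proof. by apply: measurable_stopped => k _; exact: ms. Qed.

Let bY n : bounded_rv (Y n).
Proof.
have a0 := A0; have b0 := B0.
split; [exact: mY|exists (A + B + M)] => t.
have := stopped_bounds A0 B0 (fun n => sM n t) n; rewrite -/(Y n t).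
by rewrite ler_norml => /andP[y1 y2]; apply/andP; split; lra.
Qed.

Let b_active n : bounded_rv (fun t => (active n t)%:R : R).
Proof. exact: @bounded_rv_bool _ _ R _ (measurable_active_gen (mY n)). Qed.

Let active_ind (f : R -> R) n : measurable_fun setT f ->
  independent_rv P (fun t => f (Y n t)) (s n).
Proof.
move=> mf; exact: (independent_rv_comp mf (@measurable_id _ _ _) (s_ind n)).
Qed.

Let m_act : measurable_fun setT (fun y : R => ((- A < y < B)%R%:R : R)).
Proof.
have mb : measurable_fun setT (fun y : R => - A < y < B).
  by apply: measurable_and; apply: measurable_fun_ltr => //; exact: measurable_cst.
rewrite (_ : (fun t => _) = (fun y : R => if - A < y < B then 1 else 0)).
  by apply: measurable_fun_ifT => //; exact: measurable_cst.
by apply/funext => t; case: (_ < t < _).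
Qed.

(** Each increment is a function of the past times an independent centred
    step. *)
Lemma stopped_mean n : \int[P]_t Y n t = 0.
Proof.
elim: n => [|n IH]; first by rewrite Rintegral_cst_probability.
rewrite (RintegralD_bounded P (bY n) (bounded_rvM (b_active n) (bs n))) IH add0r.
rewrite (independent_Rintegral (b_active n) (bs n)) ?s_mean ?mulr0 //.
exact: (active_ind n m_act).
Qed.

(** Each step taken while the walk is running adds the variance [v]: the cross
    term vanishes because the step is centred and independent of the past. *)
Lemma stopped_second_moment n :
  \int[P]_t (Y n t ^+ 2) = v * \sum_(0 <= k < n) \int[P]_t (active k t)%:R.
Proof.
elim: n => [|n IH].
  rewrite big_geq // mulr0 -[RHS](Rintegral_cst_probability P).
  by apply: eq_Rintegral => t _; rewrite /Y /= expr0n.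
have bYY := bounded_rvM (bY n) (bY n).
have bYa := bounded_rvM (bY n) (b_active n).
have b2 := bounded_rvM (bounded_rv_cst 2) (bounded_rvM bYa (bs n)).
have bss := bounded_rvM (bs n) (bs n).
have ba := bounded_rvM (b_active n) bss.
transitivity (\int[P]_t (Y n t * Y n t + (2 * (Y n t * (active n t)%:R * s n t)
    + (active n t)%:R * (s n t * s n t)))).
  apply: eq_Rintegral => t _; rewrite /Y /= -/(Y n t) -/(active n t).
  by case: (active n t) => /=; ring.
rewrite (RintegralD_bounded P bYY (bounded_rvD b2 ba)).
rewrite (RintegralD_bounded P b2 ba).
rewrite (RintegralZ_bounded P 2 (bounded_rvM bYa (bs n))).
rewrite (independent_Rintegral bYa (bs n)); last first.
  apply: (@active_ind (fun y => y * (- A < y < B)%R%:R)).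
  exact: measurable_funM.
rewrite s_mean mulr0 mulr0 add0r (independent_Rintegral (b_active n) bss).
  rewrite (_ : \int[P]_t (s n t * s n t) = v) ?s_var //.
  rewrite big_nat_recr //= mulrDr -IH mulrC; congr (_ + _).
have mm : measurable_fun setT (fun x : R => x * x) by exact: measurable_funM.
exact: (independent_rv_comp m_act mm (s_ind n)).
Qed.

(** The stopped walk has mean zero, is at most [- A] unless it has left
    through the top or is still running, and never exceeds [A + B + M] in
    absolute value; its second moment grows by [v] per unit of time as long
    as it is running, so it is unlikely to be running for long. *)
Lemma climb_probability (n : nat) : (0 < n)%N ->
  A / (A + B + M) - (A + B + M) ^+ 2 / (v * n%:R) <=
  fine (P [set t | B <= Y n t]).
Proof.
have a0 := A0; have b0 := B0; have m0 := M0.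
move=> n0; set C := A + B + M.
have C0 : 0 < C by rewrite /C; lra.
have mtop : measurable_fun setT (fun t => B <= Y n t).
  by apply: measurable_fun_ler => //; exact: measurable_cst.
rewrite -(Rintegral_bool P mtop).
have btop := @bounded_rv_bool _ _ R _ mtop.
set p := \int[P]_t _; set q := \int[P]_t ((active n t)%:R : R).
have Ap : A <= C * (p + q).
  have := stopped_mean n.
  have bsum := bounded_rvD btop (b_active n).
  have bZ := bounded_rvM (bounded_rv_cst C) bsum.
  have bR := bounded_rvD (bounded_rv_cst (- A)) bZ.
  have : \int[P]_t Y n t <= - A + C * (p + q).
    rewrite -(RintegralD_bounded P btop (b_active n)).
    rewrite -(RintegralZ_bounded P C bsum).
    rewrite -[X in X + _](Rintegral_cst_probability P).
    rewrite -(RintegralD_bounded P (bounded_rv_cst (- A)) bZ).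
    apply: le_Rintegral_bounded => // t.
    have := stopped_bounds A0 B0 (fun n => sM n t) n; rewrite -/(Y n t).
    rewrite /active /C => /andP[y1 y2].
    case: (leP B (Y n t)) => yB; case: (ltP (- A) (Y n t)) => yA /=;
      rewrite ?addr0 ?add0r ?mulr1 ?mulr0; lra.
  by move=> H1 H2; lra.
have qn : v * n%:R * q <= C ^+ 2.
  apply: (@le_trans _ _ (\int[P]_t (Y n t ^+ 2))).
    rewrite stopped_second_moment -mulrA ler_pM2l //.
    rewrite (_ : n%:R * q = \sum_(0 <= k < n) q); last first.
      by rewrite sumr_const_nat subn0 -[RHS]mulr_natl.
    rewrite big_nat [leRHS]big_nat; apply: ler_sum => k /andP[_ kn].
    apply: le_Rintegral_bounded => // t.
    case: (boolP (active n t)) => // /(stopped_active_le (ltnW kn)).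
    by rewrite -/(active k t) => ->.
  rewrite -[leRHS](Rintegral_cst_probability P).
  apply: le_Rintegral_bounded => [||t].
  - exact: (bounded_rvM (bY n) (bY n)).
  - exact: bounded_rv_cst.
  have := stopped_bounds A0 B0 (fun n => sM n t) n; rewrite -/(Y n t) /C => yb.
  move/andP: yb => [y1 y2].
  have : 0 <= (A + B + M - Y n t) * (A + B + M + Y n t) by apply: mulr_ge0; lra.
  by rewrite -subr_sqr subr_ge0.
have q' : q <= C ^+ 2 / (v * n%:R).
  by rewrite ler_pdivlMr ?mulr_gt0 ?ltr0n // mulrC.
apply: (@le_trans _ _ (A / C - q)); first by rewrite lerB.
by rewrite lerBlDr ler_pdivrMr // mulrC.
Qed.

End gambler.

(** * Grouping independent sigma-algebras *)

Section independent_blocks.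
Context {d : measure_display} {T : measurableType d} {R : realType}.
Variable P : probability T R.

(** The events [A] independent of [B] form a Dynkin system. *)
Lemma independent_dynkin (G : set (set T)) (B : set T) :
  setI_closed G -> G `<=` measurable -> measurable B ->
  (forall A, G A -> P (A `&` B) = (P A * P B)%E) ->
  forall A, <<s G >> A -> P (A `&` B) = (P A * P B)%E.
Proof.
move=> GI Gm mB GB A sA.
suff: <<s G >> `<=` [set A | measurable A /\ P (A `&` B) = (P A * P B)%E].
  by move=> /(_ _ sA)[].
apply: lambda_system_subset => //; last by move=> C GC; split; auto.
apply/dynkin_lambda_system; split => /=.
- by rewrite setTI probability_setT mul1e.
- move=> C [mC CB]; split; first exact: measurableC.
  rewrite setIC -setDE measureD //; last first.
    by rewrite -ge0_fin_numE // fin_num_measure.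
  rewrite [X in (_ - X)%E](_ : _ = (P C * P B)%E); last by rewrite setIC.
  rewrite probability_setC //.
  have key (x y : \bar R) : x \is a fin_num -> y \is a fin_num ->
      (y - x * y = (1 - x) * y)%E.
    by case: x => // x; case: y => // y _ _;
      rewrite -EFinM -!EFinB -EFinM mulrBl mul1r.
  by apply: key; exact: fin_num_measure.
- move=> C tC HC; have mC n : measurable (C n) by have [] := HC n.
  split; first exact: bigcupT_measurable.
  rewrite setI_bigcupl measure_bigcup //; last 2 first.
  + by move=> n _; exact: measurableI.
  + exact: trivIset_setIr.
  rewrite measure_bigcup // muleC -(fineK (fin_num_measure P B mB)).
  rewrite -nneseriesZl //; apply: eq_eseriesr => n _.
  by rewrite fineK ?fin_num_measure // muleC; have [] := HC n.
Qed.

Variables (I : choiceType) (F : I -> set (set T)).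
Hypothesis F_setT : forall i, F i setT.
Hypothesis F_setI : forall i, setI_closed (F i).
Hypothesis F_meas : forall i, F i `<=` measurable.
Hypothesis F_ind : mutually_independent P F.

Definition generated (J : set I) := <<s \bigcup_(i in J) F i >>.

(* The pi-system generating the sigma-algebra of the group [J]. *)
Let cylinder (J : set I) : set (set T) :=
  [set A | exists (K : {fset I}) (E : I -> set T),
    [/\ (forall i, i \in K -> J i), (forall i, F i (E i)) &
        A = \bigcap_(i in [set` K]) E i]].

Lemma generated_measurable J : generated J `<=` measurable.
Proof.
apply: smallest_sub; first exact: sigma_algebra_measurable.
by apply: bigcup_sub => i _; exact: F_meas.
Qed.

Let cylinder_measurable J : cylinder J `<=` measurable.
Proof.
move=> _ [K [E [_ FE ->]]]; rewrite bigcap_fset.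
by apply: bigsetI_measurable => i _; exact: F_meas (FE i).
Qed.

Let cylinder_setI J : setI_closed (cylinder J).
Proof.
move=> _ _ [K1 [E1 [J1 F1 ->]]] [K2 [E2 [J2 F2 ->]]].
exists (K1 `|` K2)%fset, (fun i => (if i \in K1 then E1 i else setT) `&`
  (if i \in K2 then E2 i else setT)); split.
- by move=> i; rewrite inE => /orP[]; [exact: J1|exact: J2].
- by move=> i; apply: F_setI; case: ifP.
- apply/seteqP; split => t.
    by move=> [h1 h2] i /= _; split; case: ifP => // iK; [exact: h1|exact: h2].
  move=> h; split => i /= iK.
    by have := h i; rewrite /= inE iK => /(_ isT)[].
  by have := h i; rewrite /= inE iK orbT => /(_ isT)[].
Qed.

Let generated_cylinder J : generated J `<=` <<s cylinder J >>.
Proof.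
apply: smallest_sub => [|A [i Ji FA]]; first exact: smallest_sigma_algebra.
apply: sub_gen_smallest.
exists [fset i]%fset, (fun j => if j == i then A else setT); split.
- by move=> j; rewrite inE => /eqP ->.
- by move=> j; case: eqP => [->|].
- by rewrite set_fset1 bigcap_set1 eqxx.
Qed.

Let cylinder_independent J K A B : J `&` K = set0 ->
  cylinder J A -> cylinder K B -> P (A `&` B) = (P A * P B)%E.
Proof.
move=> JK [K1 [E1 [J1 F1 ->]]] [K2 [E2 [J2 F2 ->]]].
have dis i : i \in K2 -> (i \in K1) = false.
  move=> i2; apply/negbTE/negP => i1.
  have : (J `&` K) i by split; [exact: J1|exact: J2].
  by rewrite JK.
pose E i := if i \in K1 then E1 i else E2 i.
have FE i : F i (E i) by rewrite /E; case: ifP.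
have -> : \bigcap_(i in [set` K1]) E1 i = \bigcap_(i in [set` K1]) E i.
  by apply: eq_bigcapr => i /= iK; rewrite /E iK.
have -> : \bigcap_(i in [set` K2]) E2 i = \bigcap_(i in [set` K2]) E i.
  by apply: eq_bigcapr => i /= iK; rewrite /E dis.
have -> : \bigcap_(i in [set` K1]) E i `&` \bigcap_(i in [set` K2]) E i =
    \bigcap_(i in [set` (K1 `|` K2)%fset]) E i.
  rewrite -bigcap_setU; congr (bigcap _ _); apply/seteqP; split => i /=.
    by rewrite inE => h; apply/orP.
  by rewrite inE => /orP.
have PE (L : {fset I}) :
    P (\bigcap_(i in [set` L]) E i) = (\prod_(i <- L) P (E i))%E.
  exact: (@F_ind L E (fun i _ => FE i)).
rewrite !PE -big_cat /=; apply: perm_big; apply: uniq_perm.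
- exact: fset_uniq.
- rewrite cat_uniq !fset_uniq andbT /=; apply/hasPn => i iK2.
  by rewrite dis.
- by move=> i; rewrite mem_cat inE.
Qed.

(** Kolmogorov grouping: two applications of Dynkin's theorem, to the
    pi-systems of finite intersections of events of the individual
    sigma-algebras. *)
Lemma generated_independent J K A B : J `&` K = set0 ->
  generated J A -> generated K B -> P (A `&` B) = (P A * P B)%E.
Proof.
move=> JK JA KB; have mB := generated_measurable KB.
apply: (independent_dynkin (@cylinder_setI J) (@cylinder_measurable J) mB);
  last exact: generated_cylinder.
move=> C JC; rewrite setIC muleC.
apply: (independent_dynkin (@cylinder_setI K) (@cylinder_measurable K));
  last exact: generated_cylinder.
  exact: cylinder_measurable JC.
by move=> D KD; rewrite setIC muleC; exact: cylinder_independent JC KD.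
Qed.

Lemma generatedS J K : J `<=` K -> generated J `<=` generated K.
Proof.
move=> JK; apply: sub_smallest2r; first exact: smallest_sigma_algebra.
exact: bigcup_subset.
Qed.

End independent_blocks.

(** * The second Borel-Cantelli lemma *)

Section borel_cantelli.
Context {d : measure_display} {T : measurableType d} {R : realType}.
Variables (P : probability T R) (G : nat -> set T) (p : R).

Definition avoids (K n : nat) := \big[setI/setT]_(0 <= i < n) ~` G (K + i).

Hypotheses (p0 : 0 < p) (mG : forall k, measurable (G k)).
Hypothesis G_ge : forall k, p <= fine (P (G k)).
Hypothesis G_ind : forall K n,
  P (avoids K n `&` ~` G (K + n)) = (P (avoids K n) * P (~` G (K + n)%N))%E.

Let mav K n : measurable (avoids K n).
Proof. by apply: bigsetI_measurable => i _; exact: measurableC. Qed.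

(* In place of the bound by [(1 - p) ^+ n], Bernoulli's inequality gives one
   that is ready for the Archimedean property. *)
Let avoids_le K n : fine (P (avoids K n)) * (1 + n%:R * p) <= 1.
Proof.
elim: n => [|n IH].
  by rewrite /avoids big_geq // probability_setT mul0r addr0 mulr1.
rewrite /avoids big_nat_recr //= -/(avoids K n) G_ind fineM ?fin_num_measure //;
  last exact: measurableC.
rewrite probability_setC // fineB ?fin_num_measure //=.
have g1 : fine (P (G (K + n))) <= 1.
  by rewrite -lee_fin fineK ?fin_num_measure // probability_le1.
have q0 : 0 <= fine (P (avoids K n)) by rewrite fine_ge0.
have p0' := p0; move: (G_ge (K + n)) g1 IH q0.
move: (fine _) (fine _) => q g pg g1 IH q0.
have n0 : 0 <= n%:R :> R by [].
rewrite -natr1; move: (n%:R : R) n0 IH => m m0 IH.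
apply: le_trans IH; rewrite -mulrA ler_wpM2l //.
have mp : 0 <= m * p by rewrite mulr_ge0 // ltW.
have : (1 - g) * (1 + (m + 1) * p) <= (1 - p) * (1 + (m + 1) * p).
  by rewrite ler_wpM2r ?lerB //; nra.
nra.
Qed.

(** The successive complements multiply, so that the probability of avoiding all
    events from [K] on is at most [1 / (1 + n * p)] for every [n]. *)
Lemma independent_infinitely_often :
  {ae P, forall t, forall K, exists2 k, (K <= k)%N & G k t}.
Proof.
have null K : P.-negligible (\bigcap_n ~` G (K + n)).
  exists (\bigcap_n ~` G (K + n)%N); split => //.
    by apply: bigcapT_measurable => n; exact: measurableC.
  set N := \bigcap_n _.
  have mN : measurable N by apply: bigcapT_measurable => n; exact: measurableC.
  have Nle n : fine (P N) * (1 + n%:R * p) <= 1.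
    apply: le_trans (avoids_le K n).
    rewrite ler_wpM2r //; first by rewrite addr_ge0 // mulr_ge0 // ltW.
    rewrite fine_le ?fin_num_measure // le_measure ?inE // => t Nt.
    rewrite /avoids; elim: n => [|n IH]; first by rewrite big_geq.
    by rewrite big_nat_recr //; split => //; exact: Nt.
  have : fine (P N) = 0; last first.
    by move=> N0; rewrite -(fineK (fin_num_measure P N mN)) N0.
  apply/eqP; rewrite eq_le fine_ge0 // andbT leNgt; apply/negP => N0.
  pose n := Num.truncn (fine (P N) * p)^-1.
  have := Nle n.+1; have : (fine (P N) * p)^-1 < n.+1%:R by exact: truncnS_gt.
  rewrite -[X in X < _]mul1r ltr_pdivrMr ?mulr_gt0 //.
  by move: (fine (P N)) (n.+1%:R) N0 => x m x0 h1 h2; lra.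
have := negligible_bigcup null; apply: negligibleS => t /= /existsNP[K HK].
by exists K => // n _ Gn; apply: HK; exists (K + n)%N => //; exact: leq_addr.
Qed.

End borel_cantelli.

(** * Deep valleys of the environment *)

Section block_start.
Variable N : nat.

(** A walk needs about the square of the height to climb, and the height aimed
    at in a block is proportional to the place where the block starts; so the
    length of a block is a multiple of the square of its start. *)
Fixpoint block_start (k : nat) : nat :=
  if k is k'.+1 then block_start k' + N * block_start k' ^ 2 else 1.

Lemma block_start_le m n : (m <= n)%N -> (block_start m <= block_start n)%N.
Proof.
move/subnK <-; elim: (n - m)%N => // k IH.
exact: leq_trans IH (leq_addr _ _).
Qed.

Lemma block_start_gt k : (0 < N)%N -> (k < block_start k)%N.
Proof.
move=> N0; elim: k => // k IH /=.
have : (0 < N * block_start k ^ 2)%N by rewrite muln_gt0 N0 expn_gt0; lia.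
lia.
Qed.

End block_start.

Section environment.
Context {d : measure_display} {Omega : measurableType d} {R : realType}.
Variables (P : probability Omega R) (omega : int -> {RV P >-> R}) (eps : R).
Hypothesis omega_iid : iid omega.
Hypothesis eps01 : 0 < eps < 1 / 2.
Hypothesis omega01 : forall x t, 0 < omega x t < 1.
Hypothesis elliptic : P [set t | eps <= omega 0 t <= 1 - eps] = 1%E.
Hypothesis E_log_rho : ('E_P[fun t => ln (rho (omega 0%R t))] = 0)%E.
Hypothesis V_log_rho : (0 < 'V_P[fun t => ln (rho (omega 0%R t))])%E.

(* Truncation makes the steps of the potential bounded everywhere, and changes
   them on a null event only. *)
Let clamp (p : R) := Num.max eps (Num.min p (1 - eps)).

Let log_rho (p : R) := ln (1 - clamp p) - ln (clamp p).

Let xi (x : int) (t : Omega) := log_rho (omega x t).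

Let clamp_bounds p : eps <= clamp p <= 1 - eps.
Proof.
have /andP[e0 e1] := eps01; rewrite /clamp le_max lexx /= ge_max ge_min lexx.
by rewrite orbT andbT; lra.
Qed.

Let log_rhoE p : eps <= p <= 1 - eps -> log_rho p = ln (rho p).
Proof.
move=> /andP[p0 p1]; have /andP[e0 e1] := eps01.
rewrite /log_rho /clamp (min_l p1) (max_r p0) /rho ln_div // posrE; lra.
Qed.

Let M := - ln eps.

Let log_rho_bounded p : `|log_rho p| <= M.
Proof.
have /andP[c0 c1] := clamp_bounds p; have /andP[e0 e1] := eps01.
have lnb q : eps <= q <= 1 - eps -> ln eps <= ln q <= 0.
  move=> /andP[q0 q1]; apply/andP; split.
    by rewrite ler_ln ?posrE //; lra.
  by apply: ln_le0; lra.
have /andP[l0 l1] := lnb _ (clamp_bounds p).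
have /andP[l2 l3] : ln eps <= ln (1 - clamp p) <= 0.
  by apply: lnb; apply/andP; split; lra.
rewrite /log_rho /M ler_norml; apply/andP; split; lra.
Qed.

Let measurable_clamp : measurable_fun setT clamp.
Proof.
apply: measurable_maxr; first exact: measurable_cst.
by apply: measurable_minr => //; exact: measurable_cst.
Qed.

Let measurable_log_rho : measurable_fun setT log_rho.
Proof.
apply: measurable_funB; apply: measurableT_comp => //; try exact: measurable_ln.
by apply: measurable_funB => //; exact: measurable_cst.
Qed.

Let mxi x : measurable_fun setT (xi x).
Proof. exact: measurableT_comp. Qed.

Let bxi x : bounded_rv (xi x).
Proof. by split=> //; exists M => t; exact: log_rho_bounded. Qed.

Let moment_omega (f : R -> R) x : measurable_fun setT f ->
  (exists C, forall p, `|f p| <= C) ->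
  \int[P]_t f (omega x t) = \int[P]_t f (omega 0 t).
Proof.
move=> mf [C fC].
have intf y : P.-integrable setT ((EFin \o f) \o omega y).
  apply: (@bounded_rv_integrable _ _ _ P (f \o omega y)); split.
    exact: measurableT_comp.
  by exists C => t; exact: fC.
have mEf : measurable_fun setT (EFin \o f) by exact: measurableT_comp.
rewrite /Rintegral; congr fine.
have -> : (\int[P]_t (f (omega x t))%:E =
    \int[distribution P (omega x)]_p (f p)%:E)%E.
  by rewrite integral_distribution.
have -> : (\int[P]_t (f (omega 0 t))%:E =
    \int[distribution P (omega 0)]_p (f p)%:E)%E.
  by rewrite integral_distribution.
by apply: eq_measure_integral => A mA _; exact: omega_iid.2.
Qed.

Let elliptic_ae : {ae P, forall t, forall x, eps <= omega x t <= 1 - eps}.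
Proof.
pose A : set R := [set p | eps <= p <= 1 - eps].
have mA : measurable A.
  have mb : measurable_fun setT (fun p : R => eps <= p <= 1 - eps).
    by apply: measurable_and; apply: measurable_fun_ler => //;
      exact: measurable_cst.
  by rewrite -[A]setTI; exact: (mb measurableT [set true]).
have null x : P.-negligible (~` [set t | eps <= omega x t <= 1 - eps]).
  have mAx : measurable (omega x @^-1` A).
    by rewrite -[_ @^-1` _]setTI; exact: (measurable_funPT (omega x)).
  exists (~` (omega x @^-1` A)); split => //; first exact: measurableC.
  rewrite probability_setC // (_ : P (omega x @^-1` A) = 1%E) ?subee //.
  by rewrite -elliptic; exact: (omega_iid.2 x 0 A mA).
have pos : {ae P, forall t, forall n : nat, eps <= omega n%:Z t <= 1 - eps}.
  by apply: ae_foralln => n; exact: null.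
have neg : {ae P, forall t, forall n : nat, eps <= omega (Negz n) t <= 1 - eps}.
  by apply: ae_foralln => n; exact: null.
apply: filterS2 pos neg => t pt nt [n|n]; [exact: pt|exact: nt].
Qed.

Let log_rho_omega : (fun t => ln (rho (omega 0 t))) =
  (fun t => ln (1 - omega 0 t) - ln (omega 0 t)).
Proof.
apply/funext => t; have /andP[w0 w1] := omega01 0 t.
by rewrite /rho ln_div // posrE subr_gt0.
Qed.

Let m_log_rho_omega : measurable_fun setT (fun t => ln (rho (omega 0 t))).
Proof.
rewrite log_rho_omega; apply: measurable_funB;
  apply: measurableT_comp => //; try exact: measurable_ln.
by apply: measurable_funB => //; exact: measurable_cst.
Qed.

Let integral_log_rho (f : R -> R) : measurable_fun setT f ->
  (\int[P]_t (f (ln (rho (omega 0 t))))%:E = \int[P]_t (f (xi 0 t))%:E)%E.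
Proof.
move=> mf; apply: ae_eq_integral => //.
- by apply: measurableT_comp => //; exact: measurableT_comp.
- by apply: measurableT_comp => //; exact: measurableT_comp.
- by apply: filterS elliptic_ae => t et _; rewrite /xi log_rhoE.
Qed.

Let xi_mean x : \int[P]_t xi x t = 0.
Proof.
rewrite (moment_omega x measurable_log_rho); last first.
  by exists M; exact: log_rho_bounded.
have := E_log_rho; rewrite unlock (integral_log_rho (@measurable_id _ _ _)).
by move=> h; rewrite /Rintegral /= h.
Qed.

Let v := \int[P]_t (xi 0 t ^+ 2).

Let xi_var x : \int[P]_t (xi x t ^+ 2) = v.
Proof.
apply: (@moment_omega (fun p => log_rho p ^+ 2)).
  exact: measurable_funX.
exists (M ^+ 2) => p.
by rewrite normrX lerXn2r ?nnegrE // (le_trans _ (log_rho_bounded p)).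
Qed.

Let v_gt0 : 0 < v.
Proof.
have := V_log_rho; rewrite /variance unlock E_log_rho /= unlock.
rewrite (_ : (fun w => _) = fun t => (ln (rho (omega 0 t)) ^+ 2)%:E); last first.
  by apply/funext => t /=; rewrite fctE /= subr0.
rewrite (@integral_log_rho (fun x => x ^+ 2)); last exact: measurable_funX.
move=> h; rewrite /v /Rintegral; apply: fine_gt0; rewrite h /=.
have /(bounded_rv_integrable P) := bounded_rvM (bxi 0) (bxi 0).
by move=> /integrable_fin_num -/(_ measurableT); rewrite fin_numElt => /andP[].
Qed.

Let F (x : int) : set (set Omega) := g_sigma_algebra_preimage (omega x).

Let F_setT x : F x setT.
Proof. by exists setT => //; rewrite setTI preimage_setT. Qed.

Let F_setI x : setI_closed (F x).
Proof.
move=> _ _ [A mA <-] [B mB <-]; exists (A `&` B); first exact: measurableI.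
by rewrite !setTI preimage_setI.
Qed.

Let F_meas x : F x `<=` measurable.
Proof. by move=> _ [A mA <-]; exact: (measurable_funPT (omega x)). Qed.

Let independent_blocks (J K : set int) (A B : set Omega) : J `&` K = set0 ->
  generated F J A -> generated F K B -> P (A `&` B) = (P A * P B)%E.
Proof. exact: (generated_independent F_setT F_setI F_meas omega_iid.1). Qed.

(* On this copy of the sample space, measurability of a function means that it
   depends on the sites in [J] only. *)
Let sitesType (J : set int) := g_sigma_algebraType (\bigcup_(x in J) F x).

Let sites_event (J : set int) (f : Omega -> R) (B : set R) :
  measurable_fun (setT : set (sitesType J)) f -> measurable B ->
  generated F J (f @^-1` B).
Proof. by move=> mf mB; rewrite -[_ @^-1` _]setTI; exact: mf. Qed.

Let sites_xi (J : set int) x : J x ->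
  measurable_fun (setT : set (sitesType J)) (xi x).
Proof.
move=> Jx _ B mB; rewrite setTI; apply: sub_gen_smallest; exists x => //.
exists (log_rho @^-1` B); last by rewrite setTI.
by rewrite -[_ @^-1` _]setTI; exact: measurable_log_rho.
Qed.

(** The two halves of the potential are walks with steps [c * xi (idx k)]: to
    the right [c = 1] and [idx k = k + 1], to the left [c = -1] and
    [idx k = - k]. *)
Section climbing_block.
Variables (c : R) (idx : nat -> int).
Hypotheses (c2 : c ^+ 2 = 1) (idx_inj : injective idx).

Let steps l k t := c * xi (idx (l + k)) t.

Let sites l n : set int := [set x | exists2 k, (k < n)%N & x = idx (l + k)].

Let sites_steps J l k : J (idx (l + k)) ->
  measurable_fun (setT : set (sitesType J)) (steps l k).
Proof.
move=> Jk; apply: measurable_funM; first exact: measurable_cst.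
exact: sites_xi.
Qed.

Let sites_stopped A B l n : measurable_fun (setT : set (sitesType (sites l n)))
  (fun t => stopped A B ((steps l)^~ t) n).
Proof.
by apply: measurable_stopped => k kn; apply: sites_steps; exists k.
Qed.

Definition climb_event (A B : R) (l n : nat) : set Omega :=
  [set t | B <= stopped A B ((steps l)^~ t) n].

Lemma climb_event_sites A B l n : generated F (sites l n) (climb_event A B l n).
Proof.
have -> : climb_event A B l n =
    (fun t => stopped A B ((steps l)^~ t) n) @^-1` `[B, +oo[.
  by apply/seteqP; split => t /=; rewrite in_itv /= andbT.
exact: (sites_event (@sites_stopped A B l n)).
Qed.

Lemma climb_event_probability A B l n : 0 < A -> 0 < B -> (0 < n)%N ->
  A / (A + B + M) - (A + B + M) ^+ 2 / (v * n%:R) <=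
  fine (P (climb_event A B l n)).
Proof.
move=> A0 B0 n0; apply: climb_probability => //.
- move=> k; apply: measurable_funM; first exact: measurable_cst.
  exact: mxi.
- move=> k t; rewrite normrM (_ : `|c| = 1) ?mul1r; first exact: log_rho_bounded.
  by apply/eqP; rewrite -sqrp_eq1 // real_normK ?num_real // c2.
- by move=> k; rewrite RintegralZ_bounded // xi_mean mulr0.
- move=> k; rewrite -(xi_var (idx (l + k))).
  by apply: eq_Rintegral => t _; rewrite exprMn c2 mul1r.
- move=> k C D mC mD.
  apply: (@independent_blocks (sites l k) [set idx (l + k)%N]).
  + apply/seteqP; split => // x [[j jk ->]] /= /idx_inj; lia.
  + exact: (sites_event (@sites_stopped A B l k)).
  + by apply: sites_event => //; apply: sites_steps.
Qed.

End climbing_block.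

Section blocks.
Variables (del : R) (D N : nat).
Hypotheses (del0 : 0 < del) (D0 : (0 < D)%N) (N0 : (0 < N)%N).
(* At the start [L k] of a block the potential is at most [M * L k] in absolute
   value, hence at most the fraction [del / 2] of the height [D * L k]. *)
Hypothesis DM : M <= del / 2 * D%:R.

Let p := del / (4 * (1 + 2 * del)).

Hypothesis N_ge : (1 + 2 * del) ^+ 2 * D%:R ^+ 2 / (v * p) <= N%:R.

Let L := block_start N.
Let len k := (N * L k ^ 2)%N.
Let height k : R := D%:R * (L k)%:R.

(** The excess [del / 2] of the climb makes up for the potential at the start of
    the block. *)
Definition valley_event k : set Omega :=
  climb_event 1 (fun j => j%:Z + 1)
    (del / 2 * height k) ((1 + del / 2) * height k) (L k) (len k) `&`
  climb_event (-1) (fun j => - j%:Z)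
    (del / 2 * height k) ((1 + del / 2) * height k) (L k) (len k).

Let L_step k : L k.+1 = (L k + len k)%N.
Proof. by []. Qed.

Let height_gt0 k : 0 < height k.
Proof. by rewrite mulr_gt0 ?ltr0n // (leq_ltn_trans _ (block_start_gt k N0)). Qed.

Let p_gt0 : 0 < p.
Proof. by have d0 := del0; apply: divr_gt0 => //; apply: mulr_gt0 => //; lra. Qed.

(* The constants [D] and [N] make the bound on the climbing probability the
   same at all scales: its first term is at least [2 * p], its second at most
   [p]. *)
Let climb_ge (c : R) (idx : nat -> int) k : c ^+ 2 = 1 -> injective idx ->
  p <= fine (P (climb_event c idx (del / 2 * height k)
    ((1 + del / 2) * height k) (L k) (len k))).
Proof.
move=> c2 idx_inj; have d0 := del0; have h0 := height_gt0 k.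
have len0 : (0 < len k)%N.
  by rewrite muln_gt0 N0 expn_gt0 (leq_ltn_trans _ (block_start_gt k N0)).
have A0 : 0 < del / 2 * height k by rewrite mulr_gt0 // divr_gt0.
have B0 : 0 < (1 + del / 2) * height k by rewrite mulr_gt0 //; lra.
apply: le_trans (climb_event_probability c2 idx_inj (L k) A0 B0 len0).
set C := _ + _ + M.
have L1 : 1 <= (L k)%:R :> R by rewrite ler1n (leq_ltn_trans _ (block_start_gt k N0)).
have Mh : M <= del / 2 * height k.
  by apply: (le_trans DM); rewrite /height ler_pM2l ?divr_gt0 // ler_peMr.
have M0 : 0 <= M := le_trans (normr_ge0 _) (log_rho_bounded 0).
have C0 : 0 < C by rewrite /C; lra.
have CH : C <= (1 + 2 * del) * height k.
  have := mulr_gt0 d0 h0; rewrite /C; lra.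
have AC : 2 * p <= del / 2 * height k / C.
  rewrite ler_pdivlMr // /p.
  apply: (@le_trans _ _ (2 * p * ((1 + 2 * del) * height k))).
    by rewrite ler_pM2l // mulr_gt0.
  by rewrite le_eqVlt /p; apply/orP; left; apply/eqP; field; lra.
have CT : C ^+ 2 / (v * (len k)%:R) <= p.
  have vl : 0 < v * (len k)%:R by rewrite mulr_gt0 // ltr0n.
  rewrite ler_pdivrMr //.
  apply: (@le_trans _ _ (((1 + 2 * del) * height k) ^+ 2)).
    by rewrite lerXn2r // nnegrE; lra.
  move: N_ge; rewrite ler_pdivrMr; last exact: (mulr_gt0 v_gt0 p_gt0).
  move=> HN.
  have -> : ((1 + 2 * del) * height k) ^+ 2 =
      (1 + 2 * del) ^+ 2 * D%:R ^+ 2 * (L k)%:R ^+ 2 by rewrite /height; ring.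
  have -> : p * (v * (len k)%:R) = N%:R * (v * p) * (L k)%:R ^+ 2.
    by rewrite /len natrM natrX; ring.
  by rewrite ler_wpM2r // sqr_ge0.
lra.
Qed.

Let past m : set int := [set x | (- (L m)%:Z < x) && (x <= (L m)%:Z)].
Let block k : set int := past k.+1 `\` past k.

Let valley_event_block k : generated F (block k) (valley_event k).
Proof.
have sub c idx A B (J : set int) :
    (forall j, (j < len k)%N -> J (idx (L k + j)%N)) ->
    generated F J (climb_event c idx A B (L k) (len k)).
  move=> HJ; apply: (generatedS _ (@climb_event_sites c idx A B (L k) (len k))).
  by move=> _ [j jn ->]; exact: HJ.
apply: (@measurableI _ (sitesType (block k))); apply: sub => j jn;
  rewrite /block /past L_step /=; split; lia.
Qed.

Let mvalley k : measurable (valley_event k).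
Proof. exact: (generated_measurable F_meas (valley_event_block (k := k))). Qed.

Let valley_event_probability k : p ^+ 2 <= fine (P (valley_event k)).
Proof.
rewrite /valley_event (independent_blocks (J := [set x | 0 < x])
  (K := [set x | x <= 0])); first last.
- apply: (generatedS _ (@climb_event_sites _ _ _ _ _ _)) => _ [j _ ->] /=; lia.
- apply: (generatedS _ (@climb_event_sites _ _ _ _ _ _)) => _ [j _ ->] /=; lia.
- by apply/seteqP; split => // x [] /=; lia.
have mE c idx A B l n : measurable (climb_event c idx A B l n).
  exact: (generated_measurable F_meas (@climb_event_sites c idx A B l n)).
rewrite fineM ?fin_num_measure // expr2.
apply: ler_pM; rewrite ?(ltW p_gt0) //; apply: climb_ge.
- by rewrite expr1n.
- by move=> i j; lia.
- by rewrite sqrrN expr1n.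
- by move=> i j; lia.
Qed.

Lemma valley_events_often :
  {ae P, forall t, forall K, exists2 k, (K <= k)%N & valley_event k t}.
Proof.
apply: (@independent_infinitely_often _ _ _ _ _ (p ^+ 2)) => //.
- by rewrite exprn_gt0.
- move=> K n; apply: (independent_blocks (J := past (K + n)) (K := block (K + n))).
  + by apply/seteqP; split => // x [] /= ? [].
  + rewrite /avoids big_nat.
    apply: (@bigsetI_measurable _ (sitesType (past (K + n)))) => i /andP[_ ilt].
    apply: (@measurableC _ (sitesType (past (K + n)))).
    apply: (generatedS _ (valley_event_block (k := K + i))) => x [/= + _].
    have : (L (K + i).+1 <= L (K + n))%N by apply: block_start_le; rewrite ltn_add2l.
    rewrite /past /=; lia.
  + apply: (@measurableC _ (sitesType (block (K + n)))).
    exact: valley_event_block.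
Qed.

Lemma valley_of_event k t : (forall x, eps <= omega x t <= 1 - eps) ->
  valley_event k t -> exists a b, [/\ (0 < a <= L k.+1)%N, (b <= L k.+1)%N &
    valley (omega^~ t) (height k) (del * height k) a b].
Proof.
move=> et [right left].
have d0 := del0; have h0 := height_gt0 k.
have A0 : 0 < del / 2 * height k by rewrite mulr_gt0 // divr_gt0.
have B0 : 0 < (1 + del / 2) * height k by rewrite mulr_gt0 //; lra.
have ML : M * (L k)%:R <= del / 2 * height k.
  by rewrite /height mulrA ler_wpM2r.
have xiE x : xi x t = ln (rho (omega x t)) by rewrite /xi log_rhoE.
have bound (c : R) (idx : nat -> int) i : `|c| = 1 -> `|c * xi (idx i) t| <= M.
  by move=> c1; rewrite normrM c1 mul1r; exact: log_rho_bounded.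
have [b [/andP[Lb bL] Vb low_b]] := climbs_shift (s := fun j => 1 * xi (j%:Z + 1) t)
  A0 (fun i => bound 1 (fun j => j%:Z + 1) i (normr1 _))
  (stopped_climbs A0 B0 right).
have [a [/andP[La aL] Va low_a]] := climbs_shift (s := fun j => -1 * xi (- j%:Z) t)
  A0 (fun i => bound (-1) (fun j => - j%:Z) i (normrN1 _))
  (stopped_climbs A0 B0 left).
have Eb n : potential (omega^~ t) n%:Z = \sum_(0 <= j < n) 1 * xi (j%:Z + 1) t.
  by rewrite potential_pos; apply: eq_bigr => j _; rewrite mul1r xiE.
have Ea n : potential (omega^~ t) (- n%:Z) = \sum_(0 <= j < n) -1 * xi (- j%:Z) t.
  by rewrite potential_neg; apply: eq_bigr => j _; rewrite mulN1r xiE.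
exists a, b; split.
- rewrite L_step aL andbT (leq_trans _ La) //.
  exact: (leq_ltn_trans _ (block_start_gt k N0)).
- by rewrite L_step.
split.
- by rewrite Eb; apply: le_trans Vb; lra.
- by rewrite Ea; apply: le_trans Va; lra.
- by move=> i ib; rewrite Eb; apply: le_trans (low_b i ib); lra.
- by move=> i ia; rewrite Ea; apply: le_trans (low_a i ia); lra.
Qed.

End blocks.

(** The blocks are independent and each of them completes a valley around the
    origin with a probability that does not depend on the scale, so infinitely
    many do.  The width of these valleys is polynomial in their depth [H],
    hence eventually smaller than any exponential. *)
Lemma deep_valleys (del : R) : 0 < del ->
  {ae P, forall t, forall C : R, exists H a b, [/\ C <= H, (0 < a)%N,
     valley (omega^~ t) H (del * H) a b &
     8 * (a + b)%:R <= expR (del * H)]}.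
Proof.
move=> d0.
have M0 : 0 <= M by exact: le_trans (normr_ge0 _) (log_rho_bounded 0).
pose D := (Num.truncn (M / (del / 2))).+1.
pose p := del / (4 * (1 + 2 * del)).
pose N := (Num.truncn ((1 + 2 * del) ^+ 2 * D%:R ^+ 2 / (v * p))).+1.
have DM : M <= del / 2 * D%:R.
  by rewrite mulrC -ler_pdivrMr ?divr_gt0 // ltW // truncnS_gt.
have N_ge : (1 + 2 * del) ^+ 2 * D%:R ^+ 2 / (v * p) <= N%:R.
  by rewrite ltW // truncnS_gt.
have D0 : (0 < D)%N by [].
have N0 : (0 < N)%N by [].
apply: filterS2 elliptic_ae (valley_events_often d0 D0 N0 DM N_ge) => t et often C.
pose q : R := del * D%:R.
have q0 : 0 < q by rewrite mulr_gt0 // ltr0n.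
(* Beyond [K] the height exceeds [C], and the cube of [q * L / 3] exceeds the
   bound [16 * (1 + N) * L ^+ 2] on eight times the width. *)
pose K := (Num.truncn (Num.max C (16 * (1 + N%:R) / (q / 3) ^+ 3))).+1.
have [k Kk Gk] := often K.
have [a [b [/andP[a0 aL] bL Hval]]] := valley_of_event d0 D0 N0 DM et Gk.
set L := (block_start N k)%:R : R.
have KL : Num.max C (16 * (1 + N%:R) / (q / 3) ^+ 3) < L.
  apply: (lt_le_trans (truncnS_gt _)); rewrite ler_nat.
  by apply: (leq_trans Kk); apply: ltnW; exact: (block_start_gt k N0).
move: KL; rewrite gt_max => /andP[CL].
rewrite ltr_pdivrMr ?exprn_gt0 ?divr_gt0 // => qL.
have L1 : 1 <= L by rewrite ler1n (leq_ltn_trans _ (block_start_gt k N0)).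
exists (D%:R * L), a, b; split => //.
  by apply: (le_trans (ltW CL)); rewrite ler_peMl ?ler1n // (le_trans _ L1).
rewrite mulrA -/q.
have abL : (a + b)%:R <= 2 * (L + N%:R * L ^+ 2).
  rewrite -natrX -natrM -natrD -natrM ler_nat mul2n -addnn.
  by apply: leq_add.
have qL3 : q * L / 3 <= expR (q * L / 3).
  by apply: le_trans (expR_ge1Dx _); rewrite lerDr.
have qL0 : 0 <= q * L / 3.
  by rewrite divr_ge0 // mulr_ge0 ?(ltW q0) // (le_trans _ L1).
have -> : expR (q * L) = expR (q * L / 3) ^+ 3.
  by rewrite -expRM_natl; congr expR; field.
have := lerXn2r 3 _ _ qL3; rewrite !nnegrE qL0 expR_ge0 => /(_ isT isT).
apply: le_trans; apply: (@le_trans _ _ (16 * (1 + N%:R) * L ^+ 2)).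
  have L2 : L <= L ^+ 2 by rewrite expr2 ler_peMl // (le_trans _ L1).
  have NN : 0 <= N%:R :> R by [].
  lra.
have -> : (q * L / 3) ^+ 3 = L * (q / 3) ^+ 3 * L ^+ 2 by field.
by rewrite ler_wpM2r ?sqr_ge0 // ltW.
Qed.

End environment.

(** * Markov chains through their histories *)

Section markov_chain.
Context {d : measure_display} {W : measurableType d} {R : realType}.
Variable Q : probability W R.
Context {S : eqType} {D : finType}.
Variables (move : S -> D -> S) (prob : S -> D -> R) (z0 : S) (Z : nat -> W -> S).

(** Histories are coded by the list of the moves, the latest move first. *)
Definition endpoint (s : seq D) : S := foldr (fun a z => move z a) z0 s.

Fixpoint history_event (s : seq D) : set W :=
  if s is a :: s' then
    history_event s' `&` [set w | Z (size s) w = endpoint s]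
  else [set w | Z 0 w = z0].

Fixpoint history_weight (s : seq D) : R :=
  if s is a :: s' then history_weight s' * prob (endpoint s') a else 1.

(** The predicates constrain the states from time [n + 1] on; [future_prob] is
    the probability of such an event for the chain started at a given state,
    computed by conditioning on the first move. *)
Fixpoint future_event (gs : seq (pred S)) (n : nat) : set W :=
  if gs is g :: gs' then [set w | g (Z n.+1 w)] `&` future_event gs' n.+1
  else setT.

Fixpoint future_prob (gs : seq (pred S)) (z : S) : R :=
  if gs is g :: gs' then
    \sum_(a : D) prob z a * ((g (move z a))%:R * future_prob gs' (move z a))
  else 1.

Hypothesis move_inj : forall z, injective (move z).
Hypothesis prob_sum : forall z, \sum_(a : D) prob z a = 1.
Hypothesis measurable_pred : forall n (g : pred S), measurable [set w | g (Z n w)].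
Hypothesis history_prob : forall s, Q (history_event s) = (history_weight s)%:E.

Let measurable_state n z : measurable [set w | Z n w = z].
Proof.
have := measurable_pred n (pred1 z); congr measurable.
by apply/seteqP; split => w /eqP.
Qed.

Lemma measurable_history s : measurable (history_event s).
Proof. by elim: s => [|a s IH] /=; [|apply: measurableI]. Qed.

Lemma measurable_future gs n : measurable (future_event gs n).
Proof. by elim: gs n => [|g gs IH] n //=; apply: measurableI. Qed.

Let trivIset_history s : trivIset setT (fun a : D => history_event (a :: s)).
Proof.
apply/trivIsetP => a b _ _ ab; apply/seteqP; split => // w /= [[_ wa] [_ wb]].
by move: ab => /eqP; apply; apply: (move_inj (z := endpoint s)); rewrite -wa -wb.
Qed.

Let measure_bigcup_fin (F : D -> set W) :
  (forall a, measurable (F a)) -> trivIset setT F ->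
  (Q (\bigcup_a F a) = \sum_(a : D) Q (F a))%E.
Proof.
move=> mF tF; have finD : finite_set [set: D] by exact: finite_finset.
rewrite measure_fin_bigcup // fsbig_finite //; apply: perm_big.
apply: uniq_perm; [exact: fset_uniq|exact: index_enum_uniq|move=> a].
by rewrite mem_index_enum in_fset_set // in_setT.
Qed.

(* The one-step extensions of a history exhaust it up to a null event, because
   their probabilities add up to its own. *)
Let history_split s (E : set W) : measurable E ->
  (Q (history_event s `&` E) = \sum_(a : D) Q (history_event (a :: s) `&` E))%E.
Proof.
move=> mE; pose U := \bigcup_a history_event (a :: s).
have mH := measurable_history.
have mU : measurable U by apply: fin_bigcup_measurable.
have Us : U `<=` history_event s by move=> w [a _ []].
have QU : Q U = Q (history_event s).
  rewrite measure_bigcup_fin // history_prob.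
  under eq_bigr do rewrite history_prob.
  by rewrite sumEFin -mulr_sumr prob_sum mulr1.
have null : Q (history_event s `\` U) = 0%E.
  rewrite measureD //; last by rewrite -ge0_fin_numE // fin_num_measure.
  rewrite (setIidr Us) [X in (_ - X)%E](_ : _ = Q (history_event s)) //.
  by rewrite subee // fin_num_measure.
rewrite (measureDI _ (measurableI _ _ (mH s) mE) mU).
rewrite [X in (X + _)%E](_ : _ = 0%E) ?add0e; last first.
  apply: (subset_measure0 _ _ _ null).
  - by apply: measurableD => //; exact: measurableI.
  - exact: measurableD.
  - by move=> w [[]].
rewrite (_ : _ `&` U = \bigcup_a (history_event (a :: s) `&` E)); last first.
  apply/seteqP; split => [w [[Hs Ew] [a _ Ha]]|w [a _ [Ha Ew]]].
    by exists a.
  split; last by exists a.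
  by split => //; case: Ha.
apply: measure_bigcup_fin; first by move=> a; exact: measurableI.
exact: trivIset_setIr.
Qed.

(** The Markov property: of a history, only its endpoint matters for the
    future. *)
Lemma history_future_prob gs s :
  Q (history_event s `&` future_event gs (size s)) =
  (history_weight s * future_prob gs (endpoint s))%:E.
Proof.
elim: gs s => [|g gs IH] s; first by rewrite setIT history_prob mulr1.
rewrite history_split; last exact: measurable_future.
rewrite /= mulr_sumr -sumEFin; apply: eq_bigr => a _.
case: (boolP (g (move (endpoint s) a))) => ga; last first.
  rewrite mul0r !mulr0; apply/eqP; rewrite -measure_le0 //.
  rewrite (_ : _ `&` _ = set0) ?measure0 //; apply/seteqP; split => // w.
  by move=> [[_ /= wa] [/=]]; rewrite wa (negbTE ga).
have := IH (a :: s); rewrite /= mul1r mulrA => <-; congr (Q _).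
apply/seteqP; split => [w [Hs [_ Fw]]|w [[Hs wa] Fw]]; first by split.
by split=> //; split => //=; rewrite /= wa.
Qed.

Lemma future_event_prob gs : Q (future_event gs 0) = (future_prob gs z0)%:E.
Proof.
have := history_future_prob gs [::]; rewrite mul1r => <-.
rewrite (measureDI _ (measurable_future gs 0) (measurable_history [::])).
rewrite [X in (X + _)%E](_ : _ = 0%E) ?add0e 1?setIC //.
have null : Q (~` history_event [::]) = 0%E.
  rewrite probability_setC //; last exact: measurable_history.
  by rewrite history_prob subee.
apply: (subset_measure0 _ _ _ null).
- by apply: measurableD; [exact: measurable_future|exact: measurable_history].
- by apply: measurableC; exact: measurable_history.
- by move=> w [].
Qed.

Lemma future_event_shift n gs m :
  future_event (nseq n xpredT ++ gs) m = future_event gs (m + n).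
Proof.
elim: n m => [|n IH] m /=; first by rewrite addn0.
by rewrite IH addnS addSn; apply/seteqP; split => w; [case|split].
Qed.

Lemma future_event_nseq K g n w :
  future_event (nseq K g) n w <-> forall k, (k < K)%N -> g (Z (n + k).+1 w).
Proof.
elim: K n => [|K IH] n //=; split.
  move=> [g0 /IH gK] [|k] kK; first by rewrite addn0.
  by rewrite addnS -addSn; exact: gK.
move=> gK; split; first by have := gK 0 isT; rewrite addn0.
by apply/IH => k kK; rewrite addSn -addnS; exact: gK.
Qed.

Lemma future_prob_cat gs z hs x :
  future_prob (gs ++ xpred1 z :: hs) x =
  future_prob (rcons gs (xpred1 z)) x * future_prob hs z.
Proof.
elim: gs x => [|g gs IH] x /=; rewrite mulr_suml; apply: eq_bigr => a _.
  rewrite mulr1 -mulrA; case: (eqVneq (move x a) z) => [->//|_].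
  by rewrite !mul0r.
by rewrite IH -!mulrA.
Qed.

Let visit n : set W := [set w | Z n w = z0].
Let avoid n K : set W := future_event (nseq K (xpredC1 z0)) n.
Let last_visit n : set W := visit n `&` \bigcap_K avoid n K.

(* The chain starts afresh at a visit to its starting point. *)
Let visit_avoid n K :
  Q (visit n `&` avoid n K) = (Q (visit n) * Q (visit 0 `&` avoid 0 K))%E.
Proof.
have E0 : Q (visit 0 `&` avoid 0 K) = (future_prob (nseq K (xpredC1 z0)) z0)%:E.
  by have := history_future_prob (nseq K (xpredC1 z0)) [::]; rewrite mul1r.
rewrite E0; case: n => [|n].
  by rewrite E0 (history_prob [::]) mul1e.
have visitE : visit n.+1 = future_event (rcons (nseq n xpredT) (xpred1 z0)) 0.
  rewrite -cats1 future_event_shift add0n /= setIT.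
  by apply/seteqP; split => w /= /eqP.
have -> : Q (visit n.+1) = (future_prob (rcons (nseq n xpredT) (xpred1 z0)) z0)%:E.
  by rewrite -future_event_prob -visitE.
rewrite -EFinM -future_prob_cat.
rewrite -future_event_prob future_event_shift add0n /=; congr (Q (_ `&` _)).
by apply/seteqP; split => w /= /eqP.
Qed.

Let mvisit n : measurable (visit n).
Proof. exact: measurable_state. Qed.

Let last_visit_cvg n :
  Q (visit n `&` avoid n K) @[K --> \oo] --> Q (last_visit n).
Proof.
have -> : last_visit n = \bigcap_K (visit n `&` avoid n K).
  apply/seteqP; split => [w [wn wa] K _|w wa].
    by split => //; exact: wa.
  by split; [have [] := wa 0 I|move=> K _; have [] := wa K I].
have mva K : measurable (visit n `&` avoid n K).
  by apply: measurableI => //; exact: measurable_future.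
apply: nonincreasing_cvg_mu => //.
- by rewrite -ge0_fin_numE // fin_num_measure.
- exact: bigcapT_measurable.
- move=> k l kl; apply/subsetPset => w [wn wl]; split => //.
  apply/future_event_nseq => i ik; move/future_event_nseq : wl; apply.
  exact: leq_trans ik kl.
Qed.

Let mlast n : measurable (last_visit n).
Proof.
by apply: measurableI => //; apply: bigcapT_measurable => K;
  exact: measurable_future.
Qed.

Let last_visit_prob n :
  Q (last_visit n) = (Q (visit n) * Q (last_visit 0))%E.
Proof.
apply: (cvg_unique _ (@last_visit_cvg n)) => //.
have -> : (fun K => Q (visit n `&` avoid n K)) =
    (fun K => (Q (visit n) * Q (visit 0 `&` avoid 0 K))%E).
  by apply/funext => K; exact: visit_avoid.
by apply: cvgeZl; [exact: fin_num_measure|exact: last_visit_cvg].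
Qed.

(** The events that [n] is the last visit are disjoint and, by the Markov
    property, have probabilities proportional to those of the visits; when the
    latter have an infinite sum, all of them must vanish. *)
Lemma recurrence : (\sum_(0 <= n <oo) Q (visit n) = +oo)%E ->
  {ae Q, forall w, infinite_set [set n | Z n w = z0]}.
Proof.
move=> visit_oo.
have q0 : Q (last_visit 0) = 0%E.
  apply/eqP; rewrite eq_le measure_ge0 andbT leNgt; apply/negP => q_gt0.
  have : (Q (\bigcup_n last_visit n) <= 1)%E.
    by apply: probability_le1; exact: bigcupT_measurable.
  rewrite measure_bigcup //; last first.
    apply/trivIsetP => m n _ _ mn; apply/seteqP; split => // w.
    wlog mltn : m n mn / (m < n)%N.
      move=> H; have [mltn|nltm|mE] := ltngtP m n; first exact: H.
        by rewrite setIC; apply: H; rewrite // eq_sym.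
      by rewrite mE eqxx in mn.
    move=> [[_ wa] [wn _]]; have mnE : (m + (n - m).-1).+1 = n.
      by rewrite -addnS prednK ?subn_gt0 // subnKC // ltnW.
    have /future_event_nseq/(_ _ (ltnSn _)) := wa (n - m).-1.+1 I.
    by rewrite mnE wn eqxx.
  rewrite (eq_eseriesr (g := fun n => (fine (Q (last_visit 0)))%:E * Q (visit n))%E);
    last by move=> n _; rewrite fineK ?fin_num_measure // muleC;
      exact: last_visit_prob.
  rewrite nneseriesZl // (_ : (\sum_(0 <= i <oo | i \in setT) _ = +oo)%E).
    by rewrite fineK ?fin_num_measure // gt0_muley.
  rewrite -visit_oo; apply: eq_eseriesl => n; exact: in_setT.
have start : {ae Q, forall w, Z 0 w = z0}.
  exists (~` visit 0); split => //; first exact: measurableC.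
  rewrite probability_setC // (_ : Q (visit 0) = 1%E) ?subee //.
  exact: (history_prob [::]).
have nolast : {ae Q, forall w, forall n, ~ last_visit n w}.
  apply: ae_foralln => n.
  have Qn : Q (last_visit n) = 0%E by rewrite last_visit_prob q0 mule0.
  exists (last_visit n); split => //.
  by move=> w /contrapT.
apply: filterS2 start nolast => w w0 wl fin.
have [n wn nmax] : exists2 n, Z n w = z0 & forall m, Z m w = z0 -> (m <= n)%N.
  have /finite_seqP[s sE] := fin.
  have inE' m : Z m w = z0 -> m \in s.
    by move=> wm; have : [set` s] m by rewrite -sE.
  have ex : exists m, Z m w == z0 by exists 0; rewrite w0.
  have ub m : Z m w == z0 -> (m <= \max_(i <- s) i)%N.
    by move=> /eqP /inE' ms; apply: (leq_bigmax_seq (F := id)).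
  case: (ex_maxnP ex ub) => n /eqP wn nmax; exists n => // m /eqP wm.
  exact: nmax.
apply: (wl n); split=> // K _; apply/future_event_nseq => k _ /=.
by apply/negP => /eqP /nmax; rewrite ltnNge leq_addr.
Qed.

End markov_chain.

(** * One walk and several walks in a fixed environment *)

Section quenched_chain.
Context {R : realType}.
Variable e : int -> R.

Definition site_move (z : int) (a : bool) : int := if a then z + 1 else z - 1.

Definition site_prob (z : int) (a : bool) : R := if a then e z else 1 - e z.

Lemma site_move_inj z : injective (site_move z).
Proof. by move=> [] [] //=; lia. Qed.

Lemma site_prob_sum z : \sum_(a : bool) site_prob z a = 1.
Proof. by rewrite big_bool /= addrC subrK. Qed.

Lemma measurable_walk_pred d (W : measurableType d) (Q : probability W R)
    (X : {RV Q >-> int}) (g : pred int) : measurable [set w | g (X w)].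
Proof.
rewrite -[X in measurable X]setTI.
by exact: (measurable_funP X measurableT [set x | g x]).
Qed.

Section walk.
Context {d : measure_display} {W : measurableType d}.
Variables (Q : probability W R) (X : nat -> {RV Q >-> int}).
Hypothesis walk : quenched_walk e 0 X.

(* The most recent move comes first in [s], so that the state at time [k] is
   reached by the last [k] entries. *)
Let position (s : seq bool) (k : nat) : int :=
  endpoint site_move 0 (drop (size s - k) s).

Let hist (s : seq bool) := history_event site_move 0 (fun n => X n) s.

Let hist_history s : hist s = history X (size s) (position s).
Proof.
elim: s => [|a s IH].
  apply/seteqP; split => w /=; first by move=> w0 [].
  by move=> /(_ 0 isT).
have pos k : (k <= size s)%N -> position (a :: s) k = position s k.
  by move=> ks; rewrite /position /= subSn.
have pos_end : position (a :: s) (size s).+1 = endpoint site_move 0 (a :: s).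
  by rewrite /position /= subnn.
rewrite /hist /= -/(hist s) IH; apply/seteqP; split => w.
  move=> [Hs wa] k; rewrite leq_eqVlt ltnS => /orP[/eqP ->|ks].
    by rewrite pos_end.
  by rewrite pos //; exact: Hs.
move=> Hs; split; last by rewrite /= Hs //= pos_end.
by move=> k ks /=; rewrite -pos // Hs //; exact: ltnW.
Qed.

(** The prescribed conditional probabilities determine the law of the
    histories.  After a null history nothing is prescribed, but then both
    sides vanish. *)
Lemma walk_history_prob s :
  Q (hist s) = (history_weight site_move site_prob 0 s)%:E.
Proof.
elim: s => [|a s IH]; first exact: (quenched_walk_start walk).
have mhist : measurable (hist s).
  by apply: measurable_history => n g; exact: measurable_walk_pred.
have mstep z : measurable [set w | X (size s).+1 w = z].
  have := measurable_walk_pred (X (size s).+1) (pred1 z); congr measurable.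
  by apply/seteqP; split => w /eqP.
rewrite /hist /= -/(hist s).
have [Q0|Qpos] := eqVneq (Q (hist s)) 0%E.
  have -> : history_weight site_move site_prob 0 s = 0.
    by have := IH; rewrite Q0 => -[].
  rewrite mul0r; apply: (subset_measure0 _ mhist) => //; exact: measurableI.
have pos_n : position s (size s) = endpoint site_move 0 s.
  by rewrite /position subnn drop0.
have Qpos' : Q (history X (size s) (position s)) != 0%E by rewrite -hist_history.
have key : cond_prob Q
    [set w | X (size s).+1 w = site_move (endpoint site_move 0 s) a] (hist s) = site_prob (endpoint site_move 0 s) a.
  rewrite hist_history -pos_n; case: a => /=.
    exact: (quenched_walk_right walk Qpos').
  exact: (quenched_walk_left walk Qpos').
rewrite setIC -(fineK (fin_num_measure Q _ (measurableI _ _ (mstep _) mhist))).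
congr EFin; move: key; rewrite /cond_prob.
move=> /(congr1 (fun x => x * fine (Q (hist s)))).
rewrite divfK; last by rewrite fine_eq0 ?fin_num_measure.
by move=> ->; rewrite mulrC IH.
Qed.

Lemma walk_return_prob n : Q [set w | X n w = 0] = (return_prob e n)%:E.
Proof.
case: n => [|n]; first exact: (quenched_walk_start walk).
have fut m z : future_prob site_move site_prob (nseq m xpredT ++ [:: xpred1 0]) z =
    iter m.+1 (kernel_op e) (fun x => (x == 0)%:R) z.
  elim: m z => [|m IH] z; rewrite /= big_bool /= /kernel_op ?mulr1 //.
  by rewrite !mul1r !IH.
rewrite /return_prob -fut -(future_event_prob site_move_inj site_prob_sum
  (fun n g => measurable_walk_pred (X n) g) walk_history_prob).
rewrite future_event_shift add0n /= setIT; congr (Q _).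
by apply/seteqP; split => w /= /eqP.
Qed.

End walk.
End quenched_chain.

Section joint_chain.
Context {R : realType} {d : measure_display} {W : measurableType d}.
Variables (Q : probability W R) (e : int -> R) (m : nat).
Variable X : 'I_m -> nat -> {RV Q >-> int}.
Hypothesis walks : forall i, quenched_walk e 0 (X i).
Hypothesis ind : mutually_independent Q (fun i => process_sigma_algebra (X i)).

(* The joint walk is a Markov chain whose moves are tuples of single moves. *)
Let joint_move (z : {ffun 'I_m -> int}) (a : {ffun 'I_m -> bool}) :
  {ffun 'I_m -> int} := [ffun i => site_move (z i) (a i)].

Let joint_prob (z : {ffun 'I_m -> int}) (a : {ffun 'I_m -> bool}) : R :=
  \prod_i site_prob e (z i) (a i).

Let origin : {ffun 'I_m -> int} := [ffun=> 0].

Let joint_walk n w : {ffun 'I_m -> int} := [ffun i => X i n w].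

Let joint_move_inj z : injective (joint_move z).
Proof.
move=> a b /ffunP ab; apply/ffunP => i; have := ab i; rewrite !ffunE.
exact: site_move_inj.
Qed.

Let joint_prob_sum z : \sum_a joint_prob z a = 1.
Proof.
rewrite /joint_prob -(bigA_distr_bigA (fun i a => site_prob e (z i) a)).
by rewrite big1 // => i _; exact: site_prob_sum.
Qed.

Let measurable_joint_walk n (g : pred {ffun 'I_m -> int}) :
  measurable [set w | g (joint_walk n w)].
Proof.
have m1 z : measurable [set w | joint_walk n w = z].
  have -> : [set w | joint_walk n w = z] = \bigcap_i [set w | X i n w == z i].
    apply/seteqP; split => w /=.
      by move=> <- i _; rewrite /= ffunE.
    by move=> wz; apply/ffunP => i; rewrite ffunE; exact/eqP/wz.
  apply: fin_bigcap_measurable => [|i _]; first exact: finite_finset.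
  exact: (measurable_walk_pred (X i n) (pred1 (z i))).
pose G k := if (choice.unpickle k : option {ffun 'I_m -> int}) is Some z then
  [set w | joint_walk n w = z /\ g z] else set0.
have -> : [set w | g (joint_walk n w)] = \bigcup_k G k.
  apply/seteqP; split => w /=.
    move=> gw; exists (choice.pickle (joint_walk n w)) => //.
    by rewrite /G choice.pickleK.
  by move=> [k _]; rewrite /G; case: (choice.unpickle _) => // z [->].
apply: bigcupT_measurable => k; rewrite /G; case: (choice.unpickle _) => // z.
case: (boolP (g z)) => gz.
  have -> : [set w | joint_walk n w = z /\ true] = [set w | joint_walk n w = z].
    by apply/seteqP; split => w /=; [case|].
  exact: m1.
by rewrite (_ : mkset _ = set0) //; apply/seteqP; split => w [].
Qed.

Let independent_prod (E : 'I_m -> set W) :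
  (forall i, process_sigma_algebra (X i) (E i)) ->
  Q (\bigcap_i E i) = (\prod_(i < m) Q (E i))%E.
Proof.
move=> HE.
have -> : \bigcap_i E i = \bigcap_(i in [set` fset_set [set: 'I_m]]) E i.
  by rewrite fset_setK //; exact: finite_finset.
rewrite ind; last by move=> i _; exact: HE.
apply: perm_big; apply: uniq_perm.
- exact: fset_uniq.
- exact: index_enum_uniq.
- move=> a; rewrite mem_index_enum in_fset_set ?in_setT //.
  exact: finite_finset.
Qed.

Let process_event i n (z : int) :
  process_sigma_algebra (X i) [set w | X i n w = z].
Proof.
apply: sub_gen_smallest; exists n => //.
by exists [set z] => //; rewrite setTI.
Qed.

Let coord i (s : seq {ffun 'I_m -> bool}) : seq bool :=
  map (fun a : {ffun 'I_m -> bool} => a i) s.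

Let joint_history s : history_event joint_move origin joint_walk s =
  \bigcap_i history_event site_move 0 (fun n => X i n) (coord i s).
Proof.
have endp t i : endpoint joint_move origin t i =
    endpoint site_move 0 (coord i t).
  by elim: t => [|a t /= <-]; rewrite ffunE.
elim: s => [|a s IH].
  apply/seteqP; split => w /=.
    by move=> /ffunP w0 i _; have := w0 i; rewrite !ffunE.
  by move=> w0; apply/ffunP => i; rewrite !ffunE; exact: w0.
rewrite /= IH; apply/seteqP; split => w.
  move=> [Hs /ffunP wa] i _; split; first exact: Hs.
  by have := wa i; rewrite size_map -(endp s) !ffunE.
move=> Hs; split; first by move=> i _; have [] := Hs i I.
apply/ffunP => i; have [_] := Hs i I.
by rewrite /= size_map -(endp s) !ffunE.
Qed.

Let joint_weight s : history_weight joint_move joint_prob origin s =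
  \prod_i history_weight site_move (site_prob e) 0 (coord i s).
Proof.
have endp t i : endpoint joint_move origin t i =
    endpoint site_move 0 (coord i t).
  by elim: t => [|a t /= <-]; rewrite ffunE.
elim: s => [|a s IH] /=; first by rewrite big1.
rewrite IH -big_split; apply: eq_bigr => i _ /=.
by rewrite endp.
Qed.

Let joint_history_prob s : Q (history_event joint_move origin joint_walk s) =
  (history_weight joint_move joint_prob origin s)%:E.
Proof.
rewrite joint_history independent_prod => [|i].
  under eq_bigr do rewrite (walk_history_prob (walks _)).
  by rewrite joint_weight prodEFin.
elim: (coord i s) => [|b t IH] /=; first exact: process_event.
apply: (@measurableI _ (g_sigma_algebraType
  (\bigcup_n g_sigma_algebra_preimage (X i n)))) => //.
exact: process_event.
Qed.

(** The probability that all [m] walks are at [0] at time [n] is the [m]-th power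
    of the return probability of one of them. *)
Lemma joint_recurrence :
  (\sum_(0 <= n <oo) (return_prob e n ^+ m)%:E = +oo)%E ->
  {ae Q, forall w, infinite_set [set n | forall i, X i n w = 0]}.
Proof.
move=> sum_oo.
have visitE n : [set w | joint_walk n w = origin] =
    \bigcap_i [set w | X i n w = 0].
  apply/seteqP; split => w /=.
    by move=> /ffunP w0 i _; have := w0 i; rewrite !ffunE.
  by move=> w0; apply/ffunP => i; rewrite !ffunE; exact: w0.
have := recurrence joint_move_inj joint_prob_sum measurable_joint_walk
  joint_history_prob.
have -> : (\sum_(0 <= n <oo) Q [set w | joint_walk n w = origin] = +oo)%E.
  rewrite -sum_oo; apply: eq_eseriesr => n _.
  rewrite visitE independent_prod; last by move=> i; exact: process_event.
  under eq_bigr do rewrite (walk_return_prob (walks _)).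
  by rewrite prodEFin prodr_const card_ord.
move=> /(_ erefl); apply: filterS => w; apply: sub_infinite_set => n /=.
by move=> /ffunP w0 i; have := w0 i; rewrite !ffunE.
Qed.

End joint_chain.

Lemma nneseries_even_le (R : realType) (f : nat -> R) : (forall n, 0 <= f n) ->
  (\sum_(1 <= n <oo) (f (2 * n)%N)%:E <= \sum_(0 <= n <oo) (f n)%:E)%E.
Proof.
move=> f0; apply: lime_le.
  by apply: is_cvg_nneseries => n _ _; rewrite lee_fin.
apply: nearW => N.
apply: (@le_trans _ _ (\sum_(0 <= n < 2 * N) (f n)%:E)%E); last first.
  by apply: nneseries_lim_ge => n _ _; rewrite lee_fin.
rewrite !sumEFin lee_fin; elim: N => [|N IH]; first by rewrite !big_geq.
rewrite (_ : 2 * N.+1 = (2 * N).+2)%N; last lia.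
rewrite [leRHS]big_nat_recr // [X in _ <= X + _]big_nat_recr //=.
apply: ler_wpDr => //; case: N IH => [|N] IH.
  by rewrite !big_geq // add0r.
by rewrite big_nat_recr //= lerD2r.
Qed.

(** * Divergence of the return probabilities and simultaneous returns *)

Theorem theorem1p2 (R : realType) (d : measure_display)
    (Omega : measurableType d) (P : probability Omega R)
    (omega : int -> {RV P >-> R})
    (omega01 : forall x t, 0 < omega x t < 1)
    (omega_iid : iid omega)
    (E_log_rho : ('E_P[fun t => ln (rho (omega 0%R t))] = 0)%E)
    (V_log_rho : (0 < 'V_P[fun t => ln (rho (omega 0%R t))])%E)
    (elliptic : exists eps : R, 0 < eps < 1 / 2 /\
      P [set t | eps <= omega 0 t <= 1 - eps] = 1%E) :
  (forall alpha : R, 0 < alpha ->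
    {ae P, forall t, forall (dW : measure_display) (W : measurableType dW)
      (Q : probability W R) (X : nat -> {RV Q >-> int}),
      quenched_walk (omega^~ t) 0 X ->
      (\sum_(1 <= n <oo) (Q [set w | X (2 * n)%N w = 0%R]) `^ alpha = +oo)%E}) /\
  (forall m : nat, (0 < m)%N ->
    {ae P, forall t, forall (dW : measure_display) (W : measurableType dW)
      (Q : probability W R) (X : 'I_m -> nat -> {RV Q >-> int}),
      (forall i, quenched_walk (omega^~ t) 0 (X i)) ->
      mutually_independent Q (fun i => process_sigma_algebra (X i)) ->
      {ae Q, forall w, infinite_set [set n | forall i, X i n w = 0]}}).
Proof.
have [eps [eps01 ell]] := elliptic.
have series alpha : 0 < alpha -> {ae P, forall t,
    (\sum_(1 <= n <oo) (return_prob (omega^~ t) (2 * n) `^ alpha)%:E = +oo)%E}.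
  move=> al0; have del0 : 0 < (4 * alpha)^-1 by rewrite invr_gt0 mulr_gt0.
  apply: filterS (deep_valleys omega_iid eps01 omega01 ell E_log_rho V_log_rho
    del0) => t deep.
  apply: valley_series_oo => //.
  move=> C; have [H [a [b]]] := deep C.
  by rewrite mulrC => Hab; exists H, a, b.
split=> [alpha al0|m m0].
  apply: filterS (series alpha al0) => t sum_oo dW W Q X walk.
  rewrite -sum_oo; apply: eq_eseriesr => n _.
  by rewrite (walk_return_prob walk) poweR_EFin.
have mR : 0 < m%:R :> R by rewrite ltr0n.
apply: filterS (series m%:R mR) => t sum_oo dW W Q X walks ind.
have ret0 n : 0 <= return_prob (omega^~ t) n.
  by rewrite -lee_fin -(walk_return_prob (walks (Ordinal m0))).
apply: (joint_recurrence walks ind).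
have even_le := @nneseries_even_le _ (fun n => return_prob (omega^~ t) n ^+ m)
  (fun n => exprn_ge0 _ (ret0 n)).
apply/eqP; rewrite -leye_eq; apply: le_trans even_le; rewrite -sum_oo.
rewrite le_eqVlt; apply/orP; left; apply/eqP; apply: eq_eseriesr => n _.
by rewrite powR_mulrn.
Qed.
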